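(* Let $\mathcal A$ be a Banach operator ideal and $1\le\lambda<\infty$. For a Banach space $X$, the following statements are equivalent. (i) $X$ has the weak $\lambda$-BAP for $\mathcal A$. (ii) For every Banach space $Y$ and for each operator $T\in\mathcal A(X;Y)$, there exists a net $(S_\alpha)$ in $\mathcal F(X)$ with $\limsup_\alpha\|TS_\alpha\|_{\mathcal A}\le\lambda\|T\|_{\mathcal A}$ such that $TS_\alpha\to T$ pointwise. (iii) For every Banach space $Y$ and for each operator $T\in\mathcal A(X;Y)$ with $\|T\|_{\mathcal A}=1$, for all sequences $(y_n^* )$ in $Y^*$ and $(x_n)$ in $X$ such that $\sum_{n=1}^\infty\|y_n^*\|\|x_n\|<\infty$, one has the inequality $$\Big|\sum_{n=1}^\infty y_n^*(Tx_n)\Big|\le\lambda\sup\Big\{\Big|\sum_{n=1}^\infty y_n^*(TSx_n)\Big|\colon S\in\mathcal F(X),\ \|TS\|_{\mathcal A}\le1\Big\}.$$ (iv) $X$ has the $\lambda$-BAP for $\mathcal A$ and $\tau^{\mathcal A^{dual}}$.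
   Context: All Banach spaces are over the same field, real or complex. $\mathcal L(X)$ denotes the bounded operators on $X$, $\mathcal F(X)$ those of finite rank, $I_X$ the identity. $(\mathcal A,\|\cdot\|_{\mathcal A})$ is a Banach operator ideal; its dual ideal is given by $T\in\mathcal A^{dual}(X;Y)$ iff $T^*\in\mathcal A(Y^*;X^* )$, with $\|T\|_{\mathcal A^{dual}}=\|T^*\|_{\mathcal A}$. $X$ has the weak $\lambda$-BAP for $\mathcal A$ if for every Banach space $Y$ and each $T\in\mathcal A(X;Y)$ there is a net $(S_\alpha)$ in $\mathcal F(X)$ such that $S_\alpha\to I_X$ pointwise and $\limsup_\alpha\|TS_\alpha\|_{\mathcal A}\le\lambda\|T\|_{\mathcal A}$. If $\tau$ is a topology on $\mathcal L(X)$, $X$ has the $\lambda$-BAP for $\mathcal A$ and $\tau$ if for every Banach space $Y$ and each $T\in\mathcal A(X;Y)$ there is a net $(S_\alpha)$ in $\mathcal F(X)$ such that $S_\alpha\to I_X$ in $\tau$ and $\limsup_\alpha\|TS_\alpha\|_{\mathcal A}\le\lambda\|T\|_{\mathcal A}$. For an operator ideal $\mathcal B$, a sequence $(w_n)$ in a Banach space $W$ is $\mathcal B$-null if there exist a Banach space $Z$, an operator $R\in\mathcal B(Z;W)$ and a norm-null sequence $(z_n)\subset Z$ with $w_n=Rz_n$ for all $n$; $c_{0,\mathcal B}(W)$ is the set of $\mathcal B$-null sequences in $W$. Let $\mathcal G^{\mathcal B}$ be the linear subspace of the projective tensor product $X^*\widehat\otimes_\pi X$ consisting of all $u=\sum_{n=1}^\infty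 x_n^*\otimes x_n$ with $(x_n^* )\in c_{0,\mathcal B}(X^* )$ and $(x_n)\in\ell_1(X)$ (absolutely summable sequences). Then $\tau^{\mathcal B}$ is the weak topology $\sigma(\mathcal L(X),\mathcal G^{\mathcal B})$ on $\mathcal L(X)$ under the duality $\langle u,T\rangle=\sum_{n=1}^\infty x_n^*(Tx_n)$. In (iv), $\mathcal B=\mathcal A^{dual}$. *)

(* Defs.v *)
From HB Require Import structures.
From mathcomp Require Import all_boot all_order all_algebra.
From mathcomp Require Import all_classical all_reals all_analysis.
From mathcomp Require Import complex lra.

Set Implicit Arguments.
Unset Strict Implicit.
Unset Printing Implicit Defensive.

Import Order.TTheory GRing.Theory Num.Theory.
Import numFieldNormedType.Exports.

Local Open Scope classical_set_scope.
Local Open Scope ring_scope.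

(* The ground field is R or R[i], selected by a [scalar_kind], so that one
   development covers the real and the complex case. *)
Variant scalar_kind := RealScalars | ComplexScalars.

Definition scalar_numFieldType (R : realType) (k : scalar_kind) :
    numFieldType :=
  match k with
  | RealScalars => R
  | ComplexScalars => R[i]
  end.

Definition scalar_field (R : realType) (k : scalar_kind) : Type :=
  scalar_numFieldType R k.

HB.instance Definition _ (R : realType) (k : scalar_kind) :=
  Num.NumField.copy (scalar_field R k) (scalar_numFieldType R k).
HB.instance Definition _ (R : realType) (k : scalar_kind) :=
  GRing.ComAlgebra.copy (scalar_field R k) (scalar_numFieldType R k)^o.
HB.instance Definition _ (R : realType) (k : scalar_kind) :=
  NormedModule.copy (scalar_field R k) (scalar_numFieldType R k)^o.

Definition to_scalar (R : realType) (k : scalar_kind) : R -> scalar_field R k :=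
  match k return R -> scalar_field R k with
  | RealScalars => fun x => x
  | ComplexScalars => fun x => (x%:C)%C
  end.

Definition real_part (R : realType) (k : scalar_kind) : scalar_field R k -> R :=
  match k return scalar_field R k -> R with
  | RealScalars => fun x => x
  | ComplexScalars => fun x => complex.Re x
  end.

Section scalar_theory.
Context {R : realType} {k : scalar_kind}.
Implicit Types (x y : R) (z : scalar_field R k).

Lemma to_scalar0 : to_scalar k (0 : R) = 0.
Proof. by case: k. Qed.

Lemma to_scalarD x y : to_scalar k (x + y) = to_scalar k x + to_scalar k y.
Proof. by case: k => //=; exact: rmorphD. Qed.

Lemma to_scalarM x y : to_scalar k (x * y) = to_scalar k x * to_scalar k y.
Proof. by case: k => //=; exact: rmorphM. Qed.

Lemma ler_to_scalar x y : (to_scalar k x <= to_scalar k y) = (x <= y).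
Proof. by case: k => //=; rewrite [LHS]lecR. Qed.

Lemma to_scalarK x : real_part (to_scalar k x) = x.
Proof. by case: k. Qed.

Lemma ltr_to_scalar x y : (to_scalar k x < to_scalar k y) = (x < y).
Proof.
by rewrite !lt_neqAle ler_to_scalar (can_eq to_scalarK).
Qed.

Lemma real_partK z : 0 <= z -> to_scalar k (real_part z) = z.
Proof.
case: k z => //= -[a b] h; have : (0 <= (a +i* b)%C :> R[i]) by exact: h.
by rewrite lecE /= => /andP[/eqP b0 _]; rewrite b0.
Qed.

Lemma real_part_ge0 z : 0 <= z -> 0 <= real_part z.
Proof. by move=> z0; rewrite -ler_to_scalar to_scalar0 real_partK. Qed.

Lemma real_part_gt0 z : 0 < z -> 0 < real_part z.
Proof. by move=> z0; rewrite -ltr_to_scalar to_scalar0 real_partK// ltW. Qed.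

End scalar_theory.

Lemma complex_complete (R : realType) (F : set_system (R[i] : numFieldType)) :
  ProperFilter F -> cauchy F -> cvg F.
Proof.
move=> FF /cauchyP Fc.
have Fc' (e : R) : 0 < e -> exists z : R[i], F [set w | `|z - w| < e%:C%C].
  move=> e0; have [|z Fz] := Fc (e%:C)%C; first by rewrite ltcR.
  by exists z; apply: filterS Fz => w; rewrite -ball_normE.
have cvg_part (p : {additive R[i] -> R}) :
    (forall z : R[i], ((`|p z|)%:C)%C <= `|z|) -> cvg (p @ F).
  move=> normp; apply: R_complete; apply/cauchy_exP => e e0.
  have [z Fz] := Fc' _ e0; exists (p z).
  change (F (p @^-1` ball (p z) e)).
  apply: filterS Fz => w /= zw; rewrite -ball_normE /=.
  have : `|p (z - w)| < e by rewrite -ltcR; apply: le_lt_trans (normp _) zw.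
  by rewrite (raddfB p).
have normcE (z : R[i]) :
    `|z| = ((Num.sqrt (complex.Re z ^+ 2 + complex.Im z ^+ 2))%:C)%C.
  by case: z => a b; rewrite normc_def.
have /cvg_ex[/= a Fa] : cvg ((@complex.Re R : {additive _ -> _}) @ F).
  apply: cvg_part => z; rewrite normcE lecR -sqrtr_sqr.
  rewrite ler_sqrt ?addr_ge0 ?sqr_ge0//.
  by rewrite lerDl sqr_ge0.
have /cvg_ex[/= b Fb] : cvg ((@complex.Im R : {additive _ -> _}) @ F).
  apply: cvg_part => z; rewrite normcE lecR -sqrtr_sqr.
  rewrite ler_sqrt ?addr_ge0 ?sqr_ge0//.
  by rewrite lerDr sqr_ge0.
suff Fab : F --> ((a +i* b)%C : (R[i] : numFieldType)) by apply: cvgP Fab.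
apply/cvgrPdist_lt => -[e e'].
rewrite ltcE /= => /andP[/eqP-> e0].
have e2 : 0 < e / 2 by rewrite divr_gt0.
move/cvgrPdist_lt : Fa => /(_ _ e2) Fa; move/cvgrPdist_lt : Fb => /(_ _ e2) Fb.
have {}Fa : F [set z | `|a - complex.Re z| < e / 2] := Fa.
have {}Fb : F [set z | `|b - complex.Im z| < e / 2] := Fb.
apply: filterS2 Fa Fb => -[c d] /= ac bd.
rewrite normcE /= ltcR; apply: (@le_lt_trans _ _ (`|a - c| + `|b - d|)).
  have s0 : 0 <= `|a - c| + `|b - d| by rewrite addr_ge0.
  rewrite -[leRHS](ger0_norm s0) -sqrtr_sqr ler_sqrt ?sqr_ge0//.
  rewrite (sqrrD `|a - c|) !real_normK ?num_real//.
  by rewrite lerD2r lerDl mulrn_wge0// mulr_ge0.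
by rewrite [ltRHS]splitr ltrD.
Qed.

Lemma scalar_complete (R : realType) (k : scalar_kind)
    (F : set_system (scalar_field R k)) :
  ProperFilter F -> cauchy F -> cvg F.
Proof.
case: k F => F; [exact: R_complete | exact: complex_complete].
Qed.

HB.instance Definition _ (R : realType) (k : scalar_kind) :=
  Uniform_isComplete.Build (scalar_field R k) (@scalar_complete R k).


Section real_norm.
Context {R : realType} {k : scalar_kind}.
Local Notation K := (scalar_field R k).

(* [normedModType K] has its norm in K; [rnorm] is the same norm read in R. *)
Definition rnorm (V : normedModType K) (x : V) : R := real_part `|x|.

Lemma to_scalar_rnorm (V : normedModType K) (x : V) :
  to_scalar k (rnorm x) = `|x|.
Proof. exact: real_partK. Qed.

Lemma rnorm_ge0 (V : normedModType K) (x : V) : 0 <= rnorm x.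
Proof. exact: real_part_ge0. Qed.

Lemma rnorm0 (V : normedModType K) : rnorm (0 : V) = 0.
Proof. by rewrite /rnorm normr0 -to_scalar0 to_scalarK. Qed.

Lemma rnorm_eq0 (V : normedModType K) (x : V) : rnorm x = 0 -> x = 0.
Proof.
by move=> x0; apply/eqP; rewrite -normr_eq0 -to_scalar_rnorm x0 to_scalar0.
Qed.

Lemma ler_rnormD (V : normedModType K) (x y : V) :
  rnorm (x + y) <= rnorm x + rnorm y.
Proof.
by rewrite -(@ler_to_scalar R k) to_scalarD !to_scalar_rnorm ler_normD.
Qed.

Lemma rnormZ (V : normedModType K) (a : K) (x : V) :
  rnorm (a *: x) = rnorm a * rnorm x.
Proof.
apply: (can_inj (@to_scalarK R k)).
by rewrite to_scalarM !to_scalar_rnorm normrZ.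
Qed.

Lemma rnormB (V : normedModType K) (x y : V) : rnorm (x - y) = rnorm (y - x).
Proof. by rewrite /rnorm distrC. Qed.

Lemma rnorm_to_scalar (a : R) : 0 <= a -> rnorm (to_scalar k a : K) = a.
Proof.
move=> a0; rewrite /rnorm ger0_norm ?to_scalarK//.
by rewrite -to_scalar0 ler_to_scalar.
Qed.

End real_norm.

Section bounded_op_def.
Context {R : realType} {k : scalar_kind}.
Local Notation K := (scalar_field R k).
Context {X Y : completeNormedModType K}.

Definition is_bounded_op (f : X -> Y) : Prop :=
  linear f /\ exists M : R, forall x, rnorm (f x) <= M * rnorm x.

Definition bounded_op_pred : {pred X -> Y} := fun f => `[< is_bounded_op f >].

Lemma bounded_op_submod_closed : submod_closed bounded_op_pred.
Proof.
split=> [|a f g]; rewrite !unfold_in.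
  apply/asboolP; split=> [b x y|]; first by rewrite /= scaler0 addr0.
  by exists 0 => x; rewrite rnorm0 mul0r.
move=> /asboolP[lf [M fM]] /asboolP[lg [N gN]]; apply/asboolP; split.
  move=> b x y; rewrite /= !fctE lf lg !scalerDr !scalerA (mulrC a b).
  by rewrite -!addrA; congr (_ + _); rewrite addrCA.
exists (rnorm a * M + N) => x; rewrite mulrDl -mulrA.
rewrite (le_trans (ler_rnormD _ _))// lerD//.
by rewrite rnormZ ler_wpM2l ?rnorm_ge0.
Qed.

End bounded_op_def.

Record bounded_op (R : realType) (k : scalar_kind)
    (X Y : completeNormedModType (scalar_field R k)) := BoundedOp {
  op_fun :> X -> Y;
  op_funP : op_fun \in bounded_op_pred
}.
Arguments BoundedOp {R k X Y}.

HB.instance Definition _ (R : realType) (k : scalar_kind)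
    (X Y : completeNormedModType (scalar_field R k)) :=
  GRing.isSubmodClosed.Build (scalar_field R k) (X -> Y) (@bounded_op_pred R k X Y)
    bounded_op_submod_closed.

Section bounded_op_structure.
Context {R : realType} {k : scalar_kind}.
Local Notation K := (scalar_field R k).
Context {X Y : completeNormedModType K}.
Implicit Types T S : bounded_op X Y.

HB.instance Definition _ := [isSub of bounded_op X Y for @op_fun R k X Y].
HB.instance Definition _ := [Choice of bounded_op X Y by <:].
HB.instance Definition _ := [SubChoice_isSubLmodule of bounded_op X Y by <:].

Lemma bounded_opP T : is_bounded_op T.
Proof. by have /asboolP := op_funP T. Qed.

HB.instance Definition _ T :=
  GRing.isLinear.Build K X Y *:%R T (bounded_opP T).1.

Definition mk_bounded_op (f : X -> Y) (fb : is_bounded_op f) : bounded_op X Y :=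
  BoundedOp f (asboolT fb).

Definition opnorm T : R := sup [set rnorm (T x) | x in [set x | rnorm x <= 1]].

Lemma opnorm_has_sup T :
  has_sup [set rnorm (T x) | x in [set x | rnorm x <= 1]].
Proof.
split; first by exists (rnorm (T 0)), 0 => //=; rewrite rnorm0.
have [_ [M TM]] := bounded_opP T; exists `|M| => _ [x /= x1 <-].
rewrite (le_trans (TM x))// (le_trans (ler_norm _))// normrM ler_piMr//.
by rewrite ger0_norm// rnorm_ge0.
Qed.

Lemma rnorm_op T x : rnorm (T x) <= opnorm T * rnorm x.
Proof.
have [/rnorm_eq0 ->|x0] := eqVneq (rnorm x) 0.
  by rewrite linear0 !rnorm0 mulr0.
have xgt0 : 0 < rnorm x by rewrite lt_neqAle eq_sym x0 rnorm_ge0.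
pose c : K := to_scalar k (rnorm x)^-1.
have rc : rnorm c = (rnorm x)^-1 by rewrite rnorm_to_scalar// invr_ge0 rnorm_ge0.
rewrite -ler_pdivrMr// mulrC -rc -rnormZ -linearZ.
apply: ub_le_sup; first by have [] := opnorm_has_sup T.
by exists (c *: x) => //=; rewrite rnormZ rc mulVf.
Qed.

Lemma opnorm_le T (M : R) : 0 <= M ->
  (forall x, rnorm (T x) <= M * rnorm x) -> opnorm T <= M.
Proof.
move=> M0 TM; apply: ge_sup; first by have [] := opnorm_has_sup T.
move=> _ [x /= x1 <-]; rewrite (le_trans (TM x))//.
by rewrite ler_piMr.
Qed.

Lemma opnorm_ge0 T : 0 <= opnorm T.
Proof.
rewrite -(rnorm0 Y) -(linear0 T); apply: ub_le_sup.
  by have [] := opnorm_has_sup T.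
by exists 0 => //=; rewrite rnorm0.
Qed.

Lemma opnormD T S : opnorm (T + S) <= opnorm T + opnorm S.
Proof.
apply: opnorm_le => [|x]; first by rewrite addr_ge0// opnorm_ge0.
by rewrite mulrDl (le_trans (ler_rnormD _ _))// lerD// rnorm_op.
Qed.

Lemma opnormZ_le (a : K) T : opnorm (a *: T) <= rnorm a * opnorm T.
Proof.
apply: opnorm_le => [|x]; first by rewrite mulr_ge0 ?opnorm_ge0// rnorm_ge0.
by rewrite rnormZ -mulrA ler_wpM2l ?rnorm_op// rnorm_ge0.
Qed.

Lemma opnormZ (a : K) T : opnorm (a *: T) = rnorm a * opnorm T.
Proof.
apply/eqP; rewrite eq_le opnormZ_le /=.
have [->|a0] := eqVneq a 0; first by rewrite rnorm0 mul0r opnorm_ge0.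
have ra : rnorm a * rnorm a^-1 = 1.
  rewrite -rnormZ /GRing.scale /= mulfV// /rnorm normr1.
  have -> : 1 = to_scalar k (1 : R) by case: (k).
  by rewrite to_scalarK.
have := opnormZ_le a^-1 (a *: T); rewrite scalerA mulVf// scale1r.
move=> /(ler_wpM2l (rnorm_ge0 a)) /le_trans; apply.
by rewrite mulrA ra mul1r.
Qed.

Lemma opnorm_eq0 T : opnorm T = 0 -> T = 0.
Proof.
move=> T0; apply/val_inj/funext => x; apply: rnorm_eq0.
apply/eqP; rewrite eq_le rnorm_ge0 andbT.
by have := rnorm_op T x; rewrite T0 mul0r.
Qed.

Let opnormK T : K := to_scalar k (opnorm T).

Let opnormKD T S : opnormK (T + S) <= opnormK T + opnormK S.
Proof. by rewrite -to_scalarD ler_to_scalar opnormD. Qed.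

Let opnormKZ (a : K) T : opnormK (a *: T) = `|a| * opnormK T.
Proof. by rewrite /opnormK opnormZ to_scalarM to_scalar_rnorm. Qed.

Let opnormK_eq0 T : opnormK T = 0 -> T = 0.
Proof.
move=> T0; apply: opnorm_eq0.
by rewrite -[LHS](@to_scalarK R k) -/(opnormK T) T0 -to_scalar0 to_scalarK.
Qed.

HB.instance Definition _ :=
  @Lmodule_isNormed.Build K (bounded_op X Y) opnormK opnormKD opnormKZ opnormK_eq0.

Lemma rnormE T : rnorm T = opnorm T.
Proof. exact: to_scalarK. Qed.

End bounded_op_structure.

Section rnorm_cvg.
Context {R : realType} {k : scalar_kind}.
Local Notation K := (scalar_field R k).

Lemma cvg_rnormP (V : normedModType K) (F : set_system V) (l : V) :
  Filter F ->
  F --> l <-> forall e : R, 0 < e -> F [set x | rnorm (l - x) < e].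
Proof.
move=> FF; split=> [/cvgrPdist_lt Fl e e0|Fl].
  have /Fl : 0 < to_scalar k e by rewrite -to_scalar0 ltr_to_scalar.
  by apply: filterS => x /=; rewrite -to_scalar_rnorm ltr_to_scalar.
apply/cvgrPdist_lt => e e0; have /Fl := real_part_gt0 e0.
apply: filterS => x /=; rewrite -(@ltr_to_scalar R k) to_scalar_rnorm.
by rewrite real_partK// ltW.
Qed.

Lemma cauchy_rnormP (V : normedModType K) (F : set_system V) :
  ProperFilter F ->
  cauchy F <-> forall e : R, 0 < e -> exists x, F [set y | rnorm (x - y) < e].
Proof.
move=> FF; split=> [/cauchyP Fc e e0|Fc].
  have [|x Fx] := Fc (to_scalar k e); first by rewrite -to_scalar0 ltr_to_scalar.
  exists x; apply: filterS Fx => y; rewrite -ball_normE /=.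
  by rewrite -to_scalar_rnorm ltr_to_scalar.
apply/cauchyP => e e0; have /Fc[x Fx] := real_part_gt0 e0.
exists x; apply: filterS Fx => y /=; rewrite -ball_normE /=.
by rewrite -(@ltr_to_scalar R k) to_scalar_rnorm real_partK// ltW.
Qed.

End rnorm_cvg.

Section bounded_op_complete.
Context {R : realType} {k : scalar_kind}.
Local Notation K := (scalar_field R k).
Context {X Y : completeNormedModType K}.

Lemma bounded_op_complete (F : set_system (bounded_op X Y)) :
  ProperFilter F -> cauchy F -> cvg F.
Proof.
move=> FF /cauchy_rnormP Fc.
have ptc x : cvg ((fun T : bounded_op X Y => T x) @ F).
  apply: cauchy_cvg; apply/cauchy_rnormP => e e0.
  have x1 : 0 < rnorm x + 1 by rewrite ltr_wpDl// rnorm_ge0.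
  have [|T0 FT0] := Fc (e / (rnorm x + 1)); first by rewrite divr_gt0.
  exists (T0 x); change (F [set T : bounded_op X Y | rnorm (T0 x - T x) < e]).
  apply: filterS FT0 => T /=; rewrite rnormE ltr_pdivlMr// => T0T.
  apply: le_lt_trans T0T; apply: le_trans (rnorm_op (T0 - T) x) _.
  by rewrite ler_wpM2l ?opnorm_ge0// lerDl.
pose f x := lim ((fun T : bounded_op X Y => T x) @ F).
have fP x (e : R) : 0 < e -> F [set T : bounded_op X Y | rnorm (f x - T x) < e].
  by move=> e0; have /cvg_rnormP /(_ e e0) := ptc x.
have f_near T0 (e : R) : F [set T | rnorm (T0 - T) < e] ->
    forall x, rnorm (T0 x - f x) <= e * rnorm x.
  move=> FT0 x; apply/ler_addgt0Pr => d d0.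
  have [T [/= T0T fT]] := filter_ex (filterI FT0 (fP x _ d0)).
  rewrite -(subrK (T x) (T0 x)) -addrA (le_trans (ler_rnormD _ _))//.
  rewrite lerD//; last by rewrite rnormB ltW.
  rewrite (le_trans (rnorm_op (T0 - T) x))// ler_wpM2r ?rnorm_ge0//.
  by rewrite -rnormE ltW.
have flin : linear f.
  move=> a x y; apply: cvg_lim => //.
  rewrite (_ : (fun T : bounded_op X Y => T (a *: x + y)) =
               (fun T : bounded_op X Y => a *: T x + T y)).
    by apply: cvgD; [apply: cvgZl_tmp; exact: ptc | exact: ptc].
  by apply/funext => T; rewrite linearP.
have fb : is_bounded_op f.
  split=> //; have [T0 FT0] := Fc 1 ltr01; exists (opnorm T0 + 1) => x.
  rewrite -(subKr (T0 x) (f x)) (le_trans (ler_rnormD _ _))// mulrDl.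
  rewrite lerD ?rnorm_op// -[- _]sub0r opprB addrC.
  by rewrite addr0 rnormB; exact: f_near.
suff : F --> (mk_bounded_op fb : bounded_op X Y) by apply: cvgP.
apply/cvg_rnormP => e e0.
have [|T0 FT0] := Fc (e / 4); first by rewrite divr_gt0.
apply: filterS (FT0) => T /= T0T.
rewrite -(subrK T0 (mk_bounded_op fb)) -addrA.
apply: le_lt_trans (ler_rnormD _ _) _.
apply: (@le_lt_trans _ _ (e / 4 + e / 4)).
  rewrite lerD//; last exact: ltW.
  rewrite rnormE opnorm_le ?divr_ge0 ?ltW// => x.
  by have := f_near _ _ FT0 x; rewrite rnormB.
lra.
Qed.

HB.instance Definition _ :=
  Uniform_isComplete.Build (bounded_op X Y) bounded_op_complete.

End bounded_op_complete.

Notation dual_space X :=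
  (bounded_op X (scalar_field _ _ : completeNormedModType _)).

Section operators.
Context {R : realType} {k : scalar_kind}.
Local Notation K := (scalar_field R k).
Implicit Types X Y Z : completeNormedModType K.

Lemma id_op_subproof X : is_bounded_op (fun x : X => x).
Proof. by split=> //; exists 1 => x; rewrite mul1r. Qed.

Definition id_op X : bounded_op X X := mk_bounded_op (id_op_subproof X).

Lemma comp_op_subproof X Y Z (S : bounded_op Y Z) (T : bounded_op X Y) :
  is_bounded_op (fun x => S (T x)).
Proof.
split=> [a x y|]; first by rewrite !linearP.
exists (opnorm S * opnorm T) => x; rewrite (le_trans (rnorm_op S _))// -mulrA.
by rewrite ler_wpM2l ?rnorm_op// opnorm_ge0.
Qed.

Definition comp_op X Y Z (S : bounded_op Y Z) (T : bounded_op X Y) :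
  bounded_op X Z := mk_bounded_op (comp_op_subproof S T).

Lemma adjoint_subproof X Y (T : bounded_op X Y) :
  is_bounded_op (fun f : dual_space Y => comp_op f T).
Proof.
split=> [a f g|]; first by apply/val_inj/funext.
exists (opnorm T) => f; rewrite !rnormE opnorm_le ?mulr_ge0 ?opnorm_ge0// => x.
rewrite (le_trans (rnorm_op f _))// (mulrC (opnorm T)) -mulrA.
by rewrite ler_wpM2l ?rnorm_op// opnorm_ge0.
Qed.

Definition adjoint X Y (T : bounded_op X Y) :
    bounded_op (dual_space Y) (dual_space X) :=
  mk_bounded_op (adjoint_subproof T).

Definition finite_rank X Y (T : bounded_op X Y) : Prop :=
  exists (n : nat) (y : 'I_n -> Y),
    forall x, exists c : 'I_n -> K, T x = \sum_i c i *: y i.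

Definition operator_class : Type :=
  forall X Y : completeNormedModType K, set (bounded_op X Y).

End operators.
Arguments operator_class : clear implicits.

Record banach_ideal (R : realType) (k : scalar_kind) := BanachIdeal {
  ideal_mem : forall X Y : completeNormedModType (scalar_field R k),
    set (bounded_op X Y);
  (* A total function; its values outside the ideal are unconstrained. *)
  ideal_norm : forall X Y : completeNormedModType (scalar_field R k),
    bounded_op X Y -> R;
  ideal_finite_rank : forall X Y (T : bounded_op X Y),
    finite_rank T -> ideal_mem T;
  ideal_memD : forall X Y (S T : bounded_op X Y),
    ideal_mem S -> ideal_mem T -> ideal_mem (S + T);
  ideal_memZ : forall X Y (a : scalar_field R k) (T : bounded_op X Y),
    ideal_mem T -> ideal_mem (a *: T);
  ideal_mem_comp : forall X0 X Y Y0 (U : bounded_op Y Y0) (T : bounded_op X Y)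
      (V : bounded_op X0 X),
    ideal_mem T -> ideal_mem (comp_op U (comp_op T V));
  ideal_normD : forall X Y (S T : bounded_op X Y),
    ideal_mem S -> ideal_mem T ->
    ideal_norm (S + T) <= ideal_norm S + ideal_norm T;
  ideal_normZ : forall X Y (a : scalar_field R k) (T : bounded_op X Y),
    ideal_mem T -> ideal_norm (a *: T) = rnorm a * ideal_norm T;
  ideal_norm_eq0 : forall X Y (T : bounded_op X Y),
    ideal_mem T -> ideal_norm T = 0 -> T = 0;
  ideal_norm_comp : forall X0 X Y Y0 (U : bounded_op Y Y0) (T : bounded_op X Y)
      (V : bounded_op X0 X),
    ideal_mem T ->
    ideal_norm (comp_op U (comp_op T V)) <= opnorm U * ideal_norm T * opnorm V;
  ideal_norm_id : ideal_norm (id_op (scalar_field R k)) = 1;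
  ideal_complete : forall X Y (T : nat -> bounded_op X Y),
    (forall n, ideal_mem (T n)) ->
    (forall e : R, 0 < e -> exists N, forall m n, (N <= m)%N -> (N <= n)%N ->
       ideal_norm (T m - T n) < e) ->
    exists2 T0, ideal_mem T0 & (ideal_norm (T n - T0)) @[n --> \oo] --> (0 : R)
}.

(* Only the underlying class of the dual ideal; its norm, T |-> the ideal norm
   of the adjoint of T, plays no role in the notion of a null sequence. *)
Definition dual_ideal (R : realType) (k : scalar_kind) (A : banach_ideal R k) :
  operator_class R k := fun X Y T => ideal_mem A (adjoint T).

Record net (T : Type) := Net {
  net_index : Type;
  net_le : net_index -> net_index -> Prop;
  net_inhabited : inhabited net_index;
  net_le_refl : forall a, net_le a a;
  net_le_trans : forall a b c, net_le a b -> net_le b c -> net_le a c;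
  net_directed : forall a b, exists c, net_le a c /\ net_le b c;
  net_val :> net_index -> T
}.

Definition net_filter (T : Type) (N : net T) : set_system (net_index N) :=
  [set P | exists a, forall b, net_le a b -> P b].
Arguments net_filter {T} N.

Definition net_limsup (R : realType) (T : Type) (N : net T) (f : T -> R) :
    \bar R :=
  limf_esup id ((f (N a))%:E @[a --> net_filter N]).

Section null_sequences_and_tensors.
Context {R : realType} {k : scalar_kind}.
Local Notation K := (scalar_field R k).
Implicit Types X Y Z W : completeNormedModType K.

Definition null_seq (B : operator_class R k) W (w : nat -> W) : Prop :=
  exists (Z : completeNormedModType K) (U : bounded_op Z W) (z : nat -> Z),
    [/\ B _ _ U, z n @[n --> \oo] --> (0 : Z) & forall n, w n = U (z n)].

Definition is_bounded_bilinear X Y (b : X -> Y -> K) : Prop :=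
  [/\ forall y, linear (b^~ y), forall x, linear (b x) &
      exists M : R, forall x y, rnorm (b x y) <= M * rnorm x * rnorm y].

Definition bilinear_form X Y : Type :=
  {b : X -> Y -> K | is_bounded_bilinear b}.

(* The dual of the completed projective tensor product of X and Y is the space
   of bounded bilinear forms on X * Y, so the product embeds isometrically in the
   functionals on bounded bilinear forms, the series of the x_n (x) y_n being
   sent to b |-> \sum_n b(x_n, y_n). Tensors are represented by these
   functionals: two series define the same tensor iff they take the same value
   at every bounded bilinear form. *)
Definition tensor_series X Y (x : nat -> X) (y : nat -> Y) :
    bilinear_form X Y -> K :=
  fun b => limn (series (fun n => sval b (x n) (y n))).

Definition proj_tensor X Y : set (bilinear_form X Y -> K) :=
  [set u | exists (x : nat -> X) (y : nat -> Y),
    (\sum_(n <oo) (rnorm (x n) * rnorm (y n))%:E < +oo)%E /\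
    u = tensor_series x y].

Definition null_tensor (B : operator_class R k) X :
    set (bilinear_form (dual_space X) X -> K) :=
  [set u | exists (f : nat -> dual_space X) (x : nat -> X),
    [/\ null_seq B f, (\sum_(n <oo) (rnorm (x n))%:E < +oo)%E &
        u = tensor_series f x]].

Lemma op_form_subproof X (T : bounded_op X X) :
  is_bounded_bilinear (fun (f : dual_space X) x => f (T x)).
Proof.
split=> [x a f g|f a x y|]; rewrite ?linearP//.
exists (opnorm T) => f x; rewrite (le_trans (rnorm_op f _))//.
rewrite rnormE (mulrC (opnorm T)) -mulrA.
by rewrite ler_wpM2l ?rnorm_op// opnorm_ge0.
Qed.

Definition op_form X (T : bounded_op X X) : bilinear_form (dual_space X) X :=
  exist _ _ (op_form_subproof T).

(* An operator T on X defines the bilinear form (f, x) |-> f (T x) on X^* * X,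
   and <u, T> is the value of the tensor u at this form. *)
Definition duality X (u : bilinear_form (dual_space X) X -> K) 
    (T : bounded_op X X) : K :=
  u (op_form T).

Lemma duality_tensor_series X (f : nat -> dual_space X) (x : nat -> X) T :
  duality (tensor_series f x) T = limn (series (fun n => f n (T (x n)))).
Proof. by []. Qed.

Lemma null_tensor_sub (B : operator_class R k) X :
  @null_tensor B X `<=` @proj_tensor (dual_space X) X.
Proof.
move=> _ [f [x [[Z [U [z [_ z0 fE]]]] xs ->]]]; exists f, x; split=> //.
have [M zM] : exists M : K, forall n, `|z n| <= M.
  have /cvg_seq_bounded[M [_ zM]] : cvgn z by apply: cvgP z0.
  by exists (M + 1) => n; apply: zM => //; rewrite ltrDl.
have {}zM n : rnorm (z n) <= `|real_part M|.
  apply: le_trans (ler_norm _); rewrite -(@ler_to_scalar R k) to_scalar_rnorm.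
  by rewrite real_partK ?zM// (le_trans _ (zM n)).
pose C := opnorm U * `|real_part M|.
have C0 : 0 <= C by rewrite mulr_ge0 ?opnorm_ge0.
have fC n : rnorm (f n) <= C.
  by rewrite fE (le_trans (rnorm_op U _))// ler_wpM2l ?opnorm_ge0.
apply: (@le_lt_trans _ _ (\sum_(n <oo) (C%:E * (rnorm (x n))%:E))%E).
  apply: lee_nneseries => n *; first by rewrite lee_fin mulr_ge0 ?rnorm_ge0.
  by rewrite -EFinM lee_fin ler_wpM2r ?rnorm_ge0.
rewrite nneseriesZl; last by move=> n _; rewrite lee_fin rnorm_ge0.
by rewrite lte_mul_pinfty// lee_fin.
Qed.

(* The open sets of the coarsest topology making T |-> <u, T> continuous for
   every u in G: the initial topology for T |-> (<u, T>)_u with values in K^G. *)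
Definition weak_op_topology X (G : set (bilinear_form (dual_space X) X -> K)) :
    set_system (bounded_op X X) :=
  @open (initial_topology (fun T : bounded_op X X =>
    (fun u : G => duality (val u) T) : {ptws G -> K})).

Definition tau_ideal (B : operator_class R k) X : set_system (bounded_op X X) :=
  weak_op_topology (@null_tensor B X).

Definition weak_BAP_for (A : banach_ideal R k) (lambda : R) X : Prop :=
  forall Y (T : bounded_op X Y), ideal_mem A T ->
    exists N : net (bounded_op X X),
      [/\ forall a, finite_rank (N a),
          forall x, N a x @[a --> net_filter N] --> x &
          (net_limsup N (fun S => ideal_norm A (comp_op T S)) <=
            (lambda * ideal_norm A T)%:E)%E].

(* [tau] is given by its open sets. *)
Definition BAP_for (A : banach_ideal R k) (lambda : R) X
    (tau : set_system (bounded_op X X)) : Prop :=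
  forall Y (T : bounded_op X Y), ideal_mem A T ->
    exists N : net (bounded_op X X),
      [/\ forall a, finite_rank (N a),
          forall O, tau O -> O (id_op X) ->
            \forall a \near net_filter N, O (N a) &
          (net_limsup N (fun S => ideal_norm A (comp_op T S)) <=
            (lambda * ideal_norm A T)%:E)%E].

End null_sequences_and_tensors.

Arguments tau_ideal {R k} B X.
Arguments weak_op_topology {R k} X G.
Arguments BAP_for {R k} A lambda X tau.
Arguments weak_BAP_for {R k} A lambda X.
Arguments null_tensor {R k} B X.
Arguments proj_tensor {R k} X Y.

(* Main.v *)
From HB Require Import structures.
Require Import Defs.
From mathcomp Require Import all_boot all_order all_algebra.
From mathcomp Require Import all_classical all_reals all_analysis.
From mathcomp Require Import complex ring lra.

(** The four properties are proved equivalent in a cycle; two of the steps are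
    limit arguments, and the other two are separation arguments.

    The property with T S_a -> T pointwise follows from S_a -> I pointwise by
    continuity of T, and it implies the trace inequality by passing to the limit
    in an absolutely convergent series ([weak_approximation_trace]).

    From the trace inequality to convergence in the topology given by the null
    tensors, the idea is to put the tensors into the operator
    ([null_tensor_augment]). A null tensor u comes from an operator
    U : Z -> X^* whose adjoint is in the ideal, so that <u, S> only depends on
    V S, where V : X -> Z^* is the restriction of that adjoint and belongs to
    the ideal. Replacing T by T' = (T, d V) with d small costs arbitrarily
    little norm, and makes u a functional of T' S of the kind occurring in the
    trace inequality. After finitely many such steps, the inequality for T' is
    exactly the dual statement to the approximation of I by finite-rank S with
    |T' S| <= lambda |T'| against the given tensors, and separation in a
    finite-dimensional space turns one into the other
    ([trace_inequality_BAP]).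

    The way back to S_a -> I pointwise is Mazur's theorem: the topology tests
    all rank-one tensors f (x) x, so I is in the closure of the convex set of
    finite-rank S with |T S| <= r for the weak operator topology, hence for the
    strong one ([BAP_weak_BAP]).

    Both separation arguments come from the Hahn-Banach theorem, obtained in
    Mazur-Orlicz form ([mazur_orlicz]) for the real and the complex field at
    once ([power_separation]). Each net is obtained from approximations at
    finitely many conditions ([approximation_net]). *)

Set Implicit Arguments.
Unset Strict Implicit.
Unset Printing Implicit Defensive.

Import Order.TTheory GRing.Theory Num.Theory.
Import numFieldNormedType.Exports.

Local Open Scope classical_set_scope.
Local Open Scope ring_scope.

(** * The Hahn-Banach theorem for sublinear functionals *)

Section sublinear_functionals.
Context {R : realType} {k : scalar_kind}.
Local Notation K := (scalar_field R k).
Context {V : lmodType K}.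
Implicit Types (p q : V -> R) (x y : V) (D : set V).

Local Notation "t %:S" := (to_scalar k t : K) (at level 2, format "t %:S").

Definition real_convex D := forall x y (s t : R), D x -> D y ->
  0 <= s -> 0 <= t -> s + t = 1 -> D (s%:S *: x + t%:S *: y).

Definition sublinear p := (forall x y, p (x + y) <= p x + p y) /\
  (forall (t : R) x, 0 < t -> p (t%:S *: x) <= t * p x).

Lemma to_scalar1 : (1 : R)%:S = 1.
Proof. by case: k. Qed.

Lemma to_scalarN (t : R) : (- t)%:S = - t%:S.
Proof. by apply/eqP; rewrite -addr_eq0 -to_scalarD addNr to_scalar0. Qed.

Lemma sublinear0 p : sublinear p -> p 0 = 0.
Proof.
move=> [_ pZ]; have := pZ 2 0; have := pZ 2^-1 0.
by rewrite !scaler0 invr_gt0 ltr0n => /(_ isT) + /(_ isT); lra.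
Qed.

Lemma sublinearZ p (t : R) x : sublinear p -> 0 <= t -> p (t%:S *: x) = t * p x.
Proof.
move=> sp; rewrite le_eqVlt => /predU1P[<-|t0].
  by rewrite to_scalar0 scale0r mul0r sublinear0.
apply/eqP; rewrite eq_le sp.2//= -ler_pdivlMl//.
by rewrite -[leLHS](_ : p (t^-1%:S *: (t%:S *: x)) = _) ?sp.2 ?invr_gt0//
  scalerA -to_scalarM mulVf ?gt_eqF// to_scalar1 scale1r.
Qed.

Lemma sublinearN p x : sublinear p -> - p (- x) <= p x.
Proof. by move=> sp; have := sp.1 x (- x); rewrite subrr sublinear0//; lra. Qed.

(** The witness is q x = inf (p (x + t d) - t e) over d in D and t >= 0.
    Since p (t d) >= t e, each term is at least - p (- x), so the infimum is
    finite; convexity of D turns t d + t' d' into (t + t') d'', which makes q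
    subadditive; and x = - d, t = 1 gives q (- d) <= - e. The lemma serves
    twice: with a general D to encode the separation problem in q, and with a
    single point to see that a minimal sublinear functional is linear. *)
Lemma sublinear_drop p D (e : R) : sublinear p -> real_convex D -> D !=set0 ->
    (forall d, D d -> e <= p d) ->
  exists q, [/\ sublinear q, forall x, q x <= p x &
                forall d, D d -> q (- d) <= - e].
Proof.
move=> sp cD [d0 Dd0] pD.
pose E x := [set r | exists d (t : R),
  [/\ D d, 0 <= t & r = p (x + t%:S *: d) - t * e]].
have E0 x : E x !=set0.
  by exists (p (x + 0%:S *: d0) - 0 * e); exists d0, 0.
have Elb x : lbound (E x) (- p (- x)).
  move=> _ [d [t [Dd t0 ->]]].
  have := sp.1 (x + t%:S *: d) (- x); rewrite addrAC subrr add0r sublinearZ//.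
  have := ler_wpM2l t0 (pD _ Dd); lra.
have Einf x r : E x r -> inf (E x) <= r.
  by apply: ge_inf; exists (- p (- x)).
have infE x r : (forall s, E x s -> r <= s) -> r <= inf (E x).
  by move=> h; apply: lb_le_inf.
exists (fun x => inf (E x)); split.
- split=> [x y|t x t0].
    rewrite -lerBlDr; apply: (infE) => _ [d [s [Dd s0 ->]]].
    rewrite lerBlDr -lerBlDl; apply: (infE) => _ [d' [s' [Dd' s0' ->]]].
    rewrite lerBlDl.
    have [s00|st0] := eqVneq (s + s') 0.
      have [-> ->] : s = 0 /\ s' = 0 by lra.
      rewrite !to_scalar0 !scale0r !mul0r !addr0 !subr0.
      apply: le_trans (sp.1 x y); apply: (Einf); exists d0, 0.
      by rewrite to_scalar0 scale0r mul0r addr0 subr0.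
    have st : 0 < s + s' by lra.
    have := sp.1 (x + s%:S *: d) (y + s'%:S *: d').
    set z := x + _ + _ => pz.
    suff : inf (E (x + y)) <= p z - (s + s') * e by lra.
    apply: (Einf).
    exists ((s / (s + s'))%:S *: d + (s' / (s + s'))%:S *: d'), (s + s').
    split; [|lra|congr (p _ - _)].
      by apply: cD => //; rewrite ?divr_ge0 ?addr_ge0// -mulrDl divff.
    rewrite scalerDr !scalerA -!to_scalarM !mulrA ![(s + s') * _]mulrC -!mulrA.
    by rewrite !divff// !mulr1 /z addrACA.
  rewrite -ler_pdivrMl//; apply: (infE) => _ [d [s [Dd s0 ->]]].
  rewrite ler_pdivrMl// mulrBr -sublinearZ ?(ltW t0)// scalerDr.
  rewrite scalerA -to_scalarM.
  by apply: (Einf); exists d, (t * s); split; rewrite ?mulrA// mulr_ge0// ltW.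
- move=> x; apply: (Einf); exists d0, 0.
  by rewrite to_scalar0 scale0r mul0r addr0 subr0.
- move=> d Dd; apply: (Einf); exists d, 1.
  by rewrite to_scalar1 scale1r mul1r addNr sublinear0// sub0r.
Qed.

Definition real_linear (F : V -> R) := (forall x y, F (x + y) = F x + F y) /\
  (forall (t : R) x, F (t%:S *: x) = t * F x).

(** Zorn's lemma, ordering functionals downwards: every sublinear q <= p
    satisfies q x >= - p (- x), so a chain has a pointwise infimum, and this
    infimum is sublinear because two members of a chain can be replaced by the
    smaller one. *)
Lemma minimal_sublinear p : sublinear p ->
  exists q, [/\ sublinear q, forall x, q x <= p x &
    forall q', sublinear q' -> (forall x, q' x <= q x) -> q' = q].
Proof.
move=> sp; pose T := {q : V -> R | sublinear q /\ forall x, q x <= p x}.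
pose le (f g : T) := `[< forall x, sval g x <= sval f x >].
have [| | | |[q [sq qp]] qmin] := @Zorn T le.
- by move=> f; apply/asboolP.
- move=> f g h /asboolP fg /asboolP gh; apply/asboolP => x.
  exact: le_trans (gh x) (fg x).
- move=> [f hf] [g hg] /asboolP/= fg /asboolP/= gf; apply/eq_exist/funext => x.
  by apply/eqP; rewrite eq_le fg gf.
- move=> A totA; have [->|A0] := eqVneq A set0.
    by exists (exist _ p (conj sp (fun=> lexx _))).
  have [f1 Af1] : A !=set0 by apply/set0P.
  pose E x := [set r | exists2 f, A f & r = sval f x].
  have E0 x : E x !=set0 by exists (sval f1 x), f1.
  have Einf x f : A f -> inf (E x) <= sval f x.
    move=> Af; apply: ge_inf; last by exists f.
    exists (- p (- x)) => _ [g Ag ->].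
    have [sg gp] := svalP g.
    have := sublinearN x sg; have := gp (- x); lra.
  have infE x r : (forall f, A f -> r <= sval f x) -> r <= inf (E x).
    by move=> h; apply: lb_le_inf => // _ [f Af ->]; exact: h.
  have sE : sublinear (fun x => inf (E x)).
    split=> [x y|t x t0].
      rewrite -lerBlDr; apply: (infE) => f Af.
      rewrite lerBlDr -lerBlDl; apply: (infE) => g Ag.
      rewrite lerBlDl; have [/asboolP gf|/asboolP fg] := totA _ _ Af Ag.
        apply: le_trans (Einf _ _ Ag) _; apply: le_trans ((svalP g).1.1 _ _) _.
        by rewrite lerD2r.
      apply: le_trans (Einf _ _ Af) _; apply: le_trans ((svalP f).1.1 _ _) _.
      by rewrite lerD2l.
    rewrite -ler_pdivrMl//; apply: (infE) => f Af; rewrite ler_pdivrMl//.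
    by apply: le_trans (Einf _ _ Af) _; apply: (svalP f).1.2.
  have Ep x : inf (E x) <= p x.
    by apply: le_trans (Einf _ _ Af1) _; exact: (svalP f1).2.
  pose g : T := exist _ (fun x => inf (E x)) (conj sE Ep).
  by exists g => f Af; apply/asboolP => x /=; exact: Einf.
exists q; split=> // q' sq' q'q.
have q'p x : q' x <= p x by apply: le_trans (qp x).
have := qmin (exist _ q' (conj sq' q'p)).
by move=> /(_ (asboolT q'q)) [].
Qed.

(** Lowering p with the singleton of y and the level p y cannot change a
    minimal p, hence p (- y) <= - p y. An odd subadditive functional is
    additive. *)
Lemma minimal_sublinear_linear p : sublinear p ->
  (forall q', sublinear q' -> (forall x, q' x <= p x) -> q' = p) ->
  real_linear p.
Proof.
move=> sp pmin.
have pN y : p (- y) = - p y.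
  apply/eqP; rewrite eq_le; apply/andP; split; last first.
    by have := sublinearN (- y) sp; rewrite opprK; lra.
  have [| | |q [sq qp qy]] := @sublinear_drop p [set y] (p y) sp.
  - move=> _ _ s t -> -> s0 t0 st /=.
    by rewrite -scalerDl -to_scalarD st to_scalar1 scale1r.
  - by exists y.
  - by move=> _ ->.
  by have := qy y erefl; rewrite (pmin q sq qp).
have pD x y : p (x + y) = p x + p y.
  apply/eqP; rewrite eq_le sp.1/=.
  have := sp.1 (- x) (- y); rewrite -opprD !pN; lra.
split=> // t x; have [t0|t0] := leP 0 t; first exact: sublinearZ.
rewrite -[t]opprK to_scalarN scaleNr pN sublinearZ// ?mulNr//.
by rewrite oppr_ge0 ltW.
Qed.

(** The Hahn-Banach theorem in the form of Mazur and Orlicz: a linear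
    functional below p can be kept above e on a convex set where p is. It
    gives separation directly, without gauges or extension from a subspace. *)
Lemma mazur_orlicz p D (e : R) : sublinear p -> real_convex D -> D !=set0 ->
    (forall d, D d -> e <= p d) ->
  exists F, [/\ real_linear F, forall x, F x <= p x &
                forall d, D d -> e <= F d].
Proof.
move=> sp cD D0 pD; have [q [sq qp qD]] := sublinear_drop sp cD D0 pD.
have [F [sF Fq Fmin]] := minimal_sublinear sq.
exists F; split.
- exact: minimal_sublinear_linear.
- by move=> x; apply: le_trans (qp x).
- by move=> d /qD dq; have := sublinearN d sF; have := Fq (- d); lra.
Qed.

End sublinear_functionals.

(** * Separation from absolutely convex sets *)

(** In the complex case phi x = F x - i F (i x), as for the
    Bohnenblust-Sobczyk extension. *)
Lemma real_linear_complexify (R : realType) (k : scalar_kind)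
    (V : lmodType (scalar_field R k)) (F : V -> R) : real_linear F ->
  exists2 phi : V -> scalar_field R k,
    linear phi & forall x, real_part (phi x) = F x.
Proof.
case: k V F => V F [FD FZ]; first by exists F => // a x y; rewrite FD FZ.
pose J : scalar_field R ComplexScalars := (0 +i* 1)%C.
have FJ (a : R[i]) x : F ((a : scalar_field R ComplexScalars) *: x) =
    complex.Re a * F x + complex.Im a * F (J *: x).
  case: a => a b /=.
  rewrite -!FZ scalerA -FD -scalerDl; congr (F (_ *: _)).
  rewrite /J /=; apply/eqP; rewrite eq_complex /=; simpc; rewrite ?eqxx //.
have FJM a x : F (J *: (a *: x)) =
    complex.Re a * F (J *: x) - complex.Im a * F x.
  rewrite scalerA (FJ (J * a)) /J; case: a => a b /=; ring.
exists (fun x => (F x +i* (- F (J *: x)))%C) => // a x y.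
rewrite scalerDr !FD FJM (FJ a) {FJ FJM}; case: a => a b.
by apply/eqP; rewrite eq_complex /=; apply/andP; split; apply/eqP => /=; ring.
Qed.

Lemma unimodular_factor (R : realType) (k : scalar_kind)
    (z : scalar_field R k) :
  exists2 a : scalar_field R k, rnorm a = 1 & a * z = to_scalar k (rnorm z).
Proof.
have r1 : rnorm (1 : scalar_field R k) = 1.
  by rewrite -[1 in LHS]to_scalar1 rnorm_to_scalar.
have [->|z0] := eqVneq z 0; first by exists 1; rewrite ?mulr0 ?rnorm0 ?to_scalar0.
exists (`|z| / z); last by rewrite divfK// to_scalar_rnorm.
rewrite /rnorm normrM normfV normr_id divff ?normr_eq0// /rnorm.
by rewrite -[1 in LHS]to_scalar1 to_scalarK.
Qed.

Section absconvex_separation.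
Context {R : realType} {k : scalar_kind}.
Local Notation K := (scalar_field R k).
Implicit Type V : lmodType K.

Definition absconvex V (C : set V) := forall (x y : V) (a b : K), C x -> C y ->
  rnorm a + rnorm b <= 1 -> C (a *: x + b *: y).

Lemma real_part_le_rnorm (z : K) : real_part z <= rnorm z.
Proof.
rewrite /rnorm; case: k z => z; first exact: ler_norm.
rewrite normc_def /=; case: z => a b /=.
rewrite (le_trans (ler_norm _))// -sqrtr_sqr ler_wsqrtr// lerDl sqr_ge0//.
Qed.

(** Apply the Mazur-Orlicz theorem to D = v - C and complexify. As C is
    balanced, c may be multiplied by the unimodular scalar that makes phi c a
    nonnegative real, so the bound on real parts becomes one on moduli; the
    same rotation bounds phi by p. *)
Lemma absconvex_separation V (p : V -> R) (C : set V) (v : V) (e : R) :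
    (forall x y, p (x + y) <= p x + p y) ->
    (forall (a : K) x, p (a *: x) = rnorm a * p x) ->
    absconvex C -> C !=set0 -> (forall c, C c -> e <= p (v - c)) ->
  exists phi : V -> K, [/\ linear phi, forall x, rnorm (phi x) <= p x &
    forall c, C c -> e + rnorm (phi c) <= rnorm (phi v)].
Proof.
move=> pD pZ aC [c0 Cc0] vC.
have sp : sublinear p.
  by split=> // t x t0; rewrite pZ rnorm_to_scalar// ltW.
have [| | |F [lF Fp FC]] := @mazur_orlicz R k V p [set v - c | c in C] e sp.
- move=> _ _ s t [c Cc <-] [d Cd <-] s0 t0 st /=.
  exists (to_scalar k s *: c + to_scalar k t *: d).
    by apply: aC => //; rewrite !rnorm_to_scalar// st.
  rewrite !scalerBr addrACA -scalerDl -to_scalarD st to_scalar1 scale1r.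
  by rewrite opprD.
- by exists (v - c0), c0.
- by move=> _ [c Cc <-]; exact: vC.
have [phi lphi phiF] := real_linear_complexify lF.
have phiZ (a : K) x : phi (a *: x) = a * phi x.
  have := lphi a x 0; have := lphi 1 0 0.
  rewrite !addr0 scaler0 scale1r -[X in X = _]addr0 => /addrI <-.
  by rewrite addr0.
have unit_phi x : exists2 a : K, rnorm a = 1 & rnorm (phi x) = F (a *: x).
  have [a a1 ax] := unimodular_factor (phi x).
  by exists a => //; rewrite -phiF phiZ ax to_scalarK.
exists phi; split=> // [x|c Cc].
  by have [a a1 ->] := unit_phi x; rewrite (le_trans (Fp _))// pZ a1 mul1r.
have [a a1 ->] := unit_phi c.
have Cac : C (a *: c).
  rewrite -[_ *: c]addr0 -[0](scale0r c); apply: aC => //.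
  by rewrite a1 rnorm0 addr0.
have /(FC _) : [set v - c | c in C] (v - a *: c) by exists (a *: c).
rewrite lF.1 -scaleN1r -to_scalar1 -to_scalarN lF.2 -phiF.
by have := real_part_le_rnorm (phi v); lra.
Qed.

End absconvex_separation.

Section separation_in_powers.
Context {R : realType} {k : scalar_kind}.
Local Notation K := (scalar_field R k).

(** Functionals on the l_1-sum of n copies of X are n-tuples of functionals
    on X. With X the scalar field this separates in a finite-dimensional
    space; with X general it is Mazur's theorem that weak and norm closures of
    convex sets agree, applied to n vectors at once. *)
Lemma power_separation (X : completeNormedModType K) (n : nat)
    (C : set ('I_n -> X)) (v : 'I_n -> X) (e : R) :
    absconvex C -> C !=set0 ->
    (forall c, C c -> e <= \sum_i rnorm (v i - c i)) ->
  exists f : 'I_n -> dual_space X, forall c, C c ->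
    e + rnorm (\sum_i f i (c i)) <= rnorm (\sum_i f i (v i)).
Proof.
move=> aC C0 vC.
have [| | |phi [lphi phip phiC]] := @absconvex_separation R k ('I_n -> X)
  (fun w => \sum_i rnorm (w i)) C v e _ _ aC C0.
- by move=> x y; rewrite -big_split ler_sum// => i _; exact: ler_rnormD.
- by move=> a x; rewrite mulr_sumr; apply: eq_bigr => i _; exact: rnormZ.
- by move=> c Cc; apply: vC.
pose inj (i : 'I_n) (x : X) : 'I_n -> X := fun j => if j == i then x else 0.
have injb i : is_bounded_op (fun x => phi (inj i x)).
  split.
    move=> a x y; rewrite -lphi; congr phi; apply/funext => j; rewrite !fctE.
    by rewrite /inj; case: ifP; rewrite // scaler0 addr0.
  exists 1 => x; rewrite mul1r (le_trans (phip _))// (bigD1 i)//= /inj eqxx.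
  rewrite big1 ?addr0// => j /negPf ->; exact: rnorm0.
exists (fun i => mk_bounded_op (injb i)).
pose phil : {linear ('I_n -> X) -> K} :=
  HB.pack phi (GRing.isLinear.Build K ('I_n -> X) K *:%R phi lphi).
have phiE w : \sum_i phi (inj i (w i)) = phi w.
  have <- : phil (\sum_i inj i (w i)) = \sum_i phi (inj i (w i)).
    by rewrite raddf_sum.
  suff -> : \sum_i inj i (w i) = w by [].
  apply/funext => j; rewrite fct_sumE (bigD1 j)//= /inj eqxx.
  by rewrite big1 ?addr0// => i; rewrite eq_sym => /negPf ->.
by move=> c Cc /=; rewrite !phiE; exact: phiC.
Qed.

End separation_in_powers.

(** * Absolutely convergent scalar series *)

Section scalar_series.
Context {R : realType} {k : scalar_kind}.
Local Notation K := (scalar_field R k).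
Implicit Types (b : nat -> R) (u v : nat -> K).

Lemma nneseries_bounded b : (forall n, 0 <= b n) ->
  (\sum_(n <oo) (b n)%:E < +oo)%E <-> exists M, forall n, series b n <= M.
Proof.
move=> b0; split=> [bs|[M bM]].
  have bfin : (\sum_(n <oo) (b n)%:E)%E \is a fin_num.
    rewrite ge0_fin_numE//; apply: nneseries_ge0 => n _ _.
    by rewrite lee_fin.
  exists (fine (\sum_(n <oo) (b n)%:E)%E) => n.
  rewrite -lee_fin fineK// /series/= -sumEFin.
  by apply: nneseries_lim_ge => i _; rewrite lee_fin.
apply: (@le_lt_trans _ _ M%:E); last exact: ltry.
apply: lime_le; first by apply: is_cvg_nneseries => n _ _; rewrite lee_fin.
by apply: nearW => n; rewrite sumEFin lee_fin; exact: bM.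
Qed.

Lemma le_series_diff b u m n : (forall i, rnorm (u i) <= b i) -> (m <= n)%N ->
  rnorm (series u n - series u m) <= series b n - series b m.
Proof.
move=> ub mn; rewrite !sub_series_geq//.
elim/big_ind2 : _ => [|x x' y y' xx' yy'|//]; first by rewrite rnorm0.
by rewrite (le_trans (ler_rnormD _ _))// lerD.
Qed.

(** The index N serves all series dominated by b at once; this is what allows
    the limit along a net to be taken term by term. *)
Lemma dominated_series b (e : R) : (forall n, 0 <= b n) ->
    (\sum_(n <oo) (b n)%:E < +oo)%E -> 0 < e ->
  exists N, forall u, (forall n, rnorm (u n) <= b n) ->
    cvgn (series u) /\ rnorm (limn (series u) - series u N) <= e.
Proof.
move=> b0 /(nneseries_bounded b0)[M bM].
have bnd : nondecreasing_seq (series b).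
  by apply: nondecreasing_series => n _ _.
have /cvg_ex[/= l bl] : cvgn (series b).
  by apply: nondecreasing_is_cvgn => //; exists M => _ [n _ <-].
have bl_ge n : series b n <= l.
  by rewrite -(cvg_lim _ bl)//; apply: nondecreasing_cvgn_le => //; apply: cvgP bl.
have tail d : 0 < d -> exists N, forall u n, (forall n, rnorm (u n) <= b n) ->
    (N <= n)%N -> rnorm (series u n - series u N) < d.
  move=> d0; move/cvgrPdist_lt : bl => /(_ _ d0)[N _ /(_ N (leqnn N)) lN].
  exists N => u n ub Nn; apply: le_lt_trans (le_series_diff ub Nn) _.
  apply: le_lt_trans lN; rewrite ger0_norm ?subr_ge0//.
  by rewrite lerD2r.
move=> e0; have [N tailN] := tail _ e0; exists N => u ub.
have cu : cvgn (series u).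
  apply: cauchy_cvg; apply/cauchy_rnormP => d d0; have [n tn] := tail _ d0.
  exists (series u n); exists n => // m /= nm.
  by rewrite rnormB; exact: tn.
split=> //; apply/ler_addgt0Pr => d d0.
have /cvg_rnormP/(_ _ d0)[n _ nP] : series u @ \oo --> limn (series u) by [].
have := nP (maxn n N) (leq_maxl _ _); rewrite /= => h.
rewrite -(subrK (series u (maxn n N)) (limn _)) -addrA addrC.
rewrite (le_trans (ler_rnormD _ _))// lerD ?ltW//.
by rewrite tailN// leq_maxr.
Qed.

Lemma cvg_dominated_series b u : (forall n, rnorm (u n) <= b n) ->
  (\sum_(n <oo) (b n)%:E < +oo)%E -> cvgn (series u).
Proof.
move=> ub bs; have b0 n : 0 <= b n by apply: le_trans (ub n); exact: rnorm_ge0.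
by have [N /(_ u ub)[]] := dominated_series b0 bs ltr01.
Qed.

Definition interleave (T : Type) (x y : nat -> T) (n : nat) : T :=
  if odd n then y n./2 else x n./2.

Lemma series_interleave (V : zmodType) (x y : nat -> V) n :
  series (interleave x y) n.*2 = series x n + series y n.
Proof.
elim: n => [|n IHn]; first by rewrite /series /= !big_geq// addr0.
rewrite doubleS !seriesSr IHn /interleave/= odd_double/= uphalf_double doubleK.
by rewrite addrACA -!addrA.
Qed.

Lemma summable_interleave b (b' : nat -> R) :
    (forall n, 0 <= b n) -> (forall n, 0 <= b' n) ->
  (\sum_(n <oo) (b n)%:E < +oo)%E -> (\sum_(n <oo) (b' n)%:E < +oo)%E ->
  (\sum_(n <oo) (interleave b b' n)%:E < +oo)%E.
Proof.
move=> b0 b0' /(nneseries_bounded b0)[M bM] /(nneseries_bounded b0')[M' bM'].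
have bb0 n : 0 <= interleave b b' n by rewrite /interleave; case: ifP.
apply/nneseries_bounded => //; exists (M + M') => n.
apply: (@le_trans _ _ (series (interleave b b') n.*2)).
  by apply: (@nondecreasing_series _ _ xpredT 0) => //; rewrite -addnn leq_addr.
by rewrite series_interleave lerD.
Qed.

Lemma lim_series_interleave u v :
    cvgn (series u) -> cvgn (series v) -> cvgn (series (interleave u v)) ->
  limn (series (interleave u v)) = limn (series u) + limn (series v).
Proof.
move=> cu cv cw.
have h : (fun n => series (interleave u v) n.*2) @ \oo -->
    limn (series u) + limn (series v).
  under eq_fun do rewrite series_interleave.
  exact: cvgD.
have h' : (fun n => series (interleave u v) n.*2) @ \oo -->
    limn (series (interleave u v)).
  apply: cvg_comp cw; move=> P [M _ MP]; exists M => // n /= Mn.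
  by apply: MP; rewrite /= (leq_trans Mn)// -addnn leq_addr.
exact: (cvg_unique _ h' h).
Qed.

End scalar_series.

(** * Products of Banach spaces and operator ideals *)

Section product_space.
Context {R : realType} {k : scalar_kind}.
Local Notation K := (scalar_field R k).
Implicit Types X Y Z : completeNormedModType K.

Lemma rnorm_fst Y Z (w : Y * Z) : rnorm w.1 <= rnorm w.
Proof.
rewrite -(@ler_to_scalar R k) !to_scalar_rnorm prod_normE.
rewrite comparable_le_max ?real_comparable ?ger0_real//.
by rewrite lexx.
Qed.

Lemma rnorm_snd Y Z (w : Y * Z) : rnorm w.2 <= rnorm w.
Proof.
rewrite -(@ler_to_scalar R k) !to_scalar_rnorm prod_normE.
rewrite comparable_le_max ?real_comparable ?ger0_real//.
by rewrite lexx orbT.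
Qed.

Lemma rnorm_pair_le Y Z (w : Y * Z) (r : R) :
  rnorm w.1 <= r -> rnorm w.2 <= r -> rnorm w <= r.
Proof.
rewrite -!(@ler_to_scalar R k) !to_scalar_rnorm prod_normE => h1 h2.
by rewrite comparable_ge_max ?h1// real_comparable// ger0_real.
Qed.

(** The operators built below take values in a product space, which has to be
    a Banach space for the approximation property to apply to them. *)
Lemma prod_complete Y Z (F : set_system ((Y * Z)%type : normedModType K)) :
  ProperFilter F -> cauchy F -> cvg F.
Proof.
move=> FF /cauchy_rnormP Fc; have FF' : Filter F := @filter_filter _ F FF.
have /cvg_ex[/= y Fy] : cvg (fst @ F).
  apply: cauchy_cvg; apply/cauchy_rnormP => e /Fc[w Fw]; exists w.1.
  change (F [set w' | rnorm (w.1 - w'.1) < e]).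
  by apply: filterS Fw => w' /=; apply: le_lt_trans; exact: (rnorm_fst (w - w')).
have /cvg_ex[/= z Fz] : cvg (snd @ F).
  apply: cauchy_cvg; apply/cauchy_rnormP => e /Fc[w Fw]; exists w.2.
  change (F [set w' | rnorm (w.2 - w'.2) < e]).
  by apply: filterS Fw => w' /=; apply: le_lt_trans; exact: (rnorm_snd (w - w')).
apply: (@cvgP ((Y * Z)%type : normedModType K) F (y, z)).
apply/cvg_rnormP => e e0.
have e2 : 0 < e / 2 by rewrite divr_gt0.
have {}Fy : F [set w | rnorm (y - w.1) < e / 2] :=
  iffLR (cvg_rnormP y (fmap_filter _ FF')) Fy _ e2.
have {}Fz : F [set w | rnorm (z - w.2) < e / 2] :=
  iffLR (cvg_rnormP z (fmap_filter _ FF')) Fz _ e2.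
apply: filterS2 Fy Fz => w /= yw zw; apply: (@le_lt_trans _ _ (e / 2)).
  by apply: rnorm_pair_le => /=; exact: ltW.
by rewrite ltr_pdivrMr// ltr_pMr// ltr1n.
Qed.

HB.instance Definition _ Y Z :=
  Uniform_isComplete.Build (Y * Z)%type (@prod_complete Y Z).

Lemma fst_op_subproof Y Z : is_bounded_op (@fst Y Z).
Proof.
by split=> //; exists 1 => w; rewrite mul1r; exact: (@rnorm_fst Y Z).
Qed.
Definition fst_op Y Z : bounded_op (Y * Z)%type Y :=
  mk_bounded_op (@fst_op_subproof Y Z).

Lemma snd_op_subproof Y Z : is_bounded_op (@snd Y Z).
Proof.
by split=> //; exists 1 => w; rewrite mul1r; exact: (@rnorm_snd Y Z).
Qed.
Definition snd_op Y Z : bounded_op (Y * Z)%type Z :=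
  mk_bounded_op (@snd_op_subproof Y Z).

Lemma inl_op_subproof Y Z : is_bounded_op (fun y : Y => (y, 0 : Z)).
Proof.
split=> [a x y|].
  by congr pair; rewrite /= scaler0 addr0.
exists 1 => y; rewrite mul1r; apply: rnorm_pair_le => //=.
by rewrite rnorm0 rnorm_ge0.
Qed.
Definition inl_op Y Z : bounded_op Y (Y * Z)%type :=
  mk_bounded_op (@inl_op_subproof Y Z).

Lemma inr_op_subproof Y Z : is_bounded_op (fun z : Z => (0 : Y, z)).
Proof.
split=> [a x y|].
  by congr pair; rewrite /= scaler0 addr0.
exists 1 => y; rewrite mul1r; apply: rnorm_pair_le => //=.
by rewrite rnorm0 rnorm_ge0.
Qed.
Definition inr_op Y Z : bounded_op Z (Y * Z)%type :=
  mk_bounded_op (@inr_op_subproof Y Z).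

Lemma opnorm_fst Y Z : opnorm (fst_op Y Z) <= 1.
Proof. by apply: opnorm_le => // w; rewrite mul1r; exact: rnorm_fst. Qed.

Lemma opnorm_inl Y Z : opnorm (inl_op Y Z) <= 1.
Proof.
apply: opnorm_le => // y; rewrite mul1r; apply: rnorm_pair_le => //=.
by rewrite rnorm0 rnorm_ge0.
Qed.

Lemma opnorm_inr Y Z : opnorm (inr_op Y Z) <= 1.
Proof.
apply: opnorm_le => // y; rewrite mul1r; apply: rnorm_pair_le => //=.
by rewrite rnorm0 rnorm_ge0.
Qed.

End product_space.

Section operators.
Context {R : realType} {k : scalar_kind}.
Local Notation K := (scalar_field R k).
Implicit Types X Y Z : completeNormedModType K.

Lemma cvg_op Y Z (U : bounded_op Y Z) (I : Type) (F : set_system I)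
    (FF : Filter F) (g : I -> Y) (y : Y) :
  g i @[i --> F] --> y -> U (g i) @[i --> F] --> U y.
Proof.
move=> /cvg_rnormP gy; apply/cvg_rnormP => e e0.
have U1 : 0 < opnorm U + 1 by rewrite ltr_wpDl// opnorm_ge0.
have {}gy : F [set i | rnorm (y - g i) < e / (opnorm U + 1)].
  by apply: gy; rewrite divr_gt0.
change (F [set i | rnorm (U y - U (g i)) < e]).
apply: filterS gy => i /=; rewrite ltr_pdivlMr// -linearB; apply: le_lt_trans.
apply: le_trans (rnorm_op _ _) _.
by rewrite mulrC ler_wpM2l ?rnorm_ge0// lerDl.
Qed.

Lemma scalar_functionalE (g : dual_space K) (a : K) : g a = g 1 * a.
Proof.
have <- : g (a *: (1 : K)) = g 1 * a by rewrite linearZ /= mulrC.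
by rewrite /GRing.scale /= mulr1.
Qed.

End operators.

Section ideals.
Context {R : realType} {k : scalar_kind}.
Local Notation K := (scalar_field R k).
Context (A : banach_ideal R k).
Implicit Types X Y Z : completeNormedModType K.

Lemma opnorm_id X : opnorm (id_op X) <= 1.
Proof. by apply: opnorm_le => // x; rewrite mul1r. Qed.

Lemma comp_op_id X Y (T : bounded_op X Y) : comp_op T (id_op X) = T.
Proof. exact/val_inj. Qed.

Lemma comp_id_op X Y (T : bounded_op X Y) : comp_op (id_op Y) T = T.
Proof. exact/val_inj. Qed.

Lemma ideal_norm_ge0 X Y (T : bounded_op X Y) :
  ideal_mem A T -> 0 <= ideal_norm A T.
Proof.
move=> AT; have AN := ideal_memZ (-1) AT.
have := ideal_normD AT AN; rewrite ideal_normZ// scaleN1r subrr.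
have -> : rnorm (-1 : K) = 1.
  by rewrite /rnorm normrN -to_scalar_rnorm -to_scalar1 rnorm_to_scalar// to_scalarK.
suff -> : ideal_norm A (0 : bounded_op X Y) = 0 by lra.
by rewrite -(scale0r T) ideal_normZ// rnorm0 mul0r.
Qed.

Lemma ideal_mem_compl X Y Z (U : bounded_op Y Z) (T : bounded_op X Y) :
  ideal_mem A T -> ideal_mem A (comp_op U T).
Proof. by move=> /(ideal_mem_comp U (id_op X)); rewrite comp_op_id. Qed.

Lemma ideal_mem_compr X Y Z (T : bounded_op Y Z) (V : bounded_op X Y) :
  ideal_mem A T -> ideal_mem A (comp_op T V).
Proof. by move=> /(ideal_mem_comp (id_op Z) V); rewrite comp_id_op. Qed.

Lemma ideal_norm_compl X Y Z (U : bounded_op Y Z) (T : bounded_op X Y) :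
  ideal_mem A T -> ideal_norm A (comp_op U T) <= opnorm U * ideal_norm A T.
Proof.
move=> AT; have := ideal_norm_comp U (id_op X) AT; rewrite comp_op_id.
move=> /le_trans; apply; rewrite ler_piMr ?opnorm_id//.
by rewrite mulr_ge0 ?opnorm_ge0// ideal_norm_ge0.
Qed.

(** The composition of f, T and the operator a |-> a x of the scalars is
    multiplication by f (T x), and the identity of the scalars has ideal norm
    1. This bounds the pairing without comparing the ideal norm of T to its
    operator norm, which would require norming functionals. *)
Lemma rnorm_functional_ideal X Y (T : bounded_op X Y) (f : dual_space Y) x :
  ideal_mem A T -> rnorm (f (T x)) <= opnorm f * ideal_norm A T * rnorm x.
Proof.
move=> AT.
have xb : is_bounded_op (fun a : K => a *: x).
  split=> [a b c|]; first by rewrite scalerDl scalerA.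
  by exists (rnorm x) => a; rewrite rnormZ mulrC.
pose x' : bounded_op K X := mk_bounded_op xb.
have -> : rnorm (f (T x)) = ideal_norm A (comp_op f (comp_op T x')).
  have -> : comp_op f (comp_op T x') = f (T x) *: id_op K.
    apply/val_inj/funext => a.
    by rewrite /= !linearZ /= /GRing.scale /= mulrC.
  rewrite ideal_normZ ?ideal_norm_id ?mulr1//.
  apply: ideal_finite_rank; exists 1%N, (fun=> 1) => a; exists (fun=> a).
  by rewrite big_ord1 /GRing.scale /= mulr1.
apply: le_trans (ideal_norm_comp f x' AT) _.
rewrite ler_wpM2l ?mulr_ge0 ?opnorm_ge0 ?ideal_norm_ge0//.
by apply: opnorm_le => [|a]; rewrite ?rnorm_ge0//= rnormZ mulrC.
Qed.

Lemma finite_rankZ X Y (a : K) (S : bounded_op X Y) :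
  finite_rank S -> finite_rank (a *: S).
Proof.
move=> [n [y Sy]]; exists n, y => x; have [c Sx] := Sy x.
exists (fun i => a * c i); rewrite -[LHS]/(a *: S x) Sx scaler_sumr.
by apply: eq_bigr => i _; rewrite scalerA.
Qed.

Lemma finite_rankD X Y (S T : bounded_op X Y) :
  finite_rank S -> finite_rank T -> finite_rank (S + T).
Proof.
move=> [n [y Sy]] [m [z Tz]].
exists (n + m)%N, (fun i : 'I_(n + m) =>
  match fintype.split i with inl j => y j | inr j => z j end).
move=> x; have [c Sx] := Sy x; have [d Tx] := Tz x.
exists (fun i : 'I_(n + m) =>
  match fintype.split i with inl j => c j | inr j => d j end).
rewrite -[LHS]/(S x + T x) Sx Tx big_split_ord/=; congr (_ + _).
  by apply: eq_bigr => i _; rewrite (unsplitK (inl i)).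
by apply: eq_bigr => i _; rewrite (unsplitK (inr i)).
Qed.

Lemma finite_rank0 X Y : finite_rank (0 : bounded_op X Y).
Proof. by exists 0%N, (fun=> 0) => x; exists (fun=> 0); rewrite big_ord0. Qed.

Lemma comp_opD X Y Z (T : bounded_op Y Z) (S S' : bounded_op X Y) :
  comp_op T (S + S') = comp_op T S + comp_op T S'.
Proof. by apply/val_inj/funext => x /=; exact: linearD. Qed.

Lemma comp_opZ X Y Z (T : bounded_op Y Z) a (S : bounded_op X Y) :
  comp_op T (a *: S) = a *: comp_op T S.
Proof. by apply/val_inj/funext => x /=; exact: linearZ. Qed.

Definition ideal_ball X Y (T : bounded_op X Y) (r : R) : set (bounded_op X X) :=
  [set S | finite_rank S /\ ideal_norm A (comp_op T S) <= r].

(** These are the sets from which a point is separated below: absolute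
    convexity comes from the triangle inequality for the ideal norm. *)
Lemma absconvex_ideal_ball X Y (T : bounded_op X Y) (r : R) :
  ideal_mem A T -> 0 <= r -> absconvex (ideal_ball T r).
Proof.
move=> AT r0 S S' a b [fS TS] [fS' TS'] ab; split.
  by apply: finite_rankD; exact: finite_rankZ.
have AS := ideal_mem_compr S AT; have AS' := ideal_mem_compr S' AT.
rewrite comp_opD !comp_opZ.
apply: le_trans (ideal_normD (ideal_memZ _ AS) (ideal_memZ _ AS')) _.
rewrite !ideal_normZ//; have a0 := rnorm_ge0 a; have b0 := rnorm_ge0 b.
have := ler_wpM2l a0 TS; have := ler_wpM2l b0 TS'.
have := ler_wpM2r r0 ab; lra.
Qed.

Lemma ideal_ball0 X Y (T : bounded_op X Y) (r : R) :
  ideal_mem A T -> 0 <= r -> ideal_ball T r 0.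
Proof.
move=> AT r0; split; first exact: finite_rank0.
rewrite -(scale0r 0) comp_opZ ideal_normZ ?rnorm0 ?mul0r//.
exact: ideal_mem_compr.
Qed.

End ideals.

(** * Nets and the weak topology on operators *)

Section nets.
Context {R : realType}.

Global Instance net_filter_proper (T : Type) (N : net T) :
  ProperFilter (net_filter N).
Proof.
split; first by move=> [a Pa]; exact: Pa (net_le_refl a).
split=> [|P Q [a aP] [b bQ]|P Q PQ [a aP]].
- by have [a] := net_inhabited N; exists a.
- have [c [ac bc]] := net_directed a b; exists c => d cd; split.
    by apply: aP; exact: net_le_trans cd.
  by apply: bQ; exact: net_le_trans cd.
- by exists a => b /aP /PQ.
Qed.

Lemma net_limsup_leP (T : Type) (N : net T) (f : T -> R) (c : R) :
  (net_limsup N f <= c%:E)%E <->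
  forall e, 0 < e -> \forall a \near net_filter N, f (N a) <= c + e.
Proof.
rewrite /net_limsup limf_esupE; split=> [fc e e0|fc].
  have : (ereal_inf [set ereal_sup (id @` V) | V in
      (f (N a))%:E @[a --> net_filter N]] < (c + e)%:E)%E.
    by apply: le_lt_trans fc _; rewrite lte_fin ltrDl.
  move=> /ereal_inf_lt[_ [V FV <-] Vc]; rewrite image_id in Vc.
  have {}FV : \forall a \near net_filter N, V (f (N a))%:E by exact: FV.
  apply: filterS FV => a Va; rewrite -lee_fin.
  by apply: le_trans (ltW Vc); exact: ereal_sup_ubound.
apply/lee_addgt0Pr => e e0; apply: ereal_inf_le.
exists (ereal_sup [set x | (x <= (c + e)%:E)%E]); last first.
  by apply: ge_ereal_sup => x /=; rewrite EFinD.
exists [set x | (x <= (c + e)%:E)%E]; last by rewrite image_id.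
have := fc e e0; change ((\forall a \near net_filter N, f (N a) <= c + e) ->
  (\forall a \near net_filter N, ((f (N a))%:E <= (c + e)%:E)%E)).
by apply: filterS => a; rewrite lee_fin.
Qed.

(** The net is indexed by pairs of a finite list s of conditions and an
    integer n, its value at (s, n) being an approximation for s with error
    1 / (n + 1). *)
Lemma approximation_net (T : Type) (J : eqType) (Q : set T) (d : J -> T -> R)
    (f : T -> R) (c : R) :
    (forall (s : seq J) (e : R), 0 < e ->
      exists S, [/\ Q S, f S <= c + e & {in s, forall j, d j S < e}]) ->
  exists N : net T, [/\ forall a, Q (N a),
    forall j e, 0 < e -> \forall a \near net_filter N, d j (N a) < e &
    (net_limsup N f <= c%:E)%E].
Proof.
move=> appr.
have inv0 n : 0 < n.+1%:R^-1 :> R by rewrite invr_gt0.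
have [S SP] := choice (fun i : seq J * nat => appr i.1 _ (inv0 i.2)).
pose le (i j : seq J * nat) := {subset i.1 <= j.1} /\ (i.2 <= j.2)%N.
have le_refl i : le i i by split.
have le_trans i j l : le i j -> le j l -> le i l.
  move=> [ij1 ij2] [jl1 jl2]; split; last exact: leq_trans jl2.
  by move=> x /ij1 /jl1.
have le_dir i j : exists l, le i l /\ le j l.
  exists (i.1 ++ j.1, maxn i.2 j.2); rewrite /le /= leq_maxl leq_maxr.
  by split; split=> // x xi; rewrite mem_cat xi ?orbT.
pose N := Net (inhabits ([::], 0%N)) le_refl le_trans le_dir S.
have inv_lt e : 0 < e -> exists n, forall m, (n <= m)%N -> m.+1%:R^-1 < e :> R.
  move=> e0; have [n _ nP] := near_infty_natSinv_lt (PosNum e0).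
  by exists n => m nm; exact: nP.
exists N; split=> [a|j e e0|].
- by have [] := SP a.
- have [n ne] := inv_lt _ e0; exists ([:: j], n) => -[s m] [/= js nm].
  have [_ _ sd] := SP (s, m); apply: lt_trans (ne _ nm).
  by apply: sd; apply: js; rewrite mem_head.
- apply/net_limsup_leP => e e0; have [n ne] := inv_lt _ e0.
  exists ([::], n) => -[s m] [/= _ nm]; have [_ fc _] := SP (s, m).
  by apply: Order.POrderTheory.le_trans fc _; rewrite lerD2l ltW// ne.
Qed.

End nets.

Section weak_operator_topology.
Context {R : realType} {k : scalar_kind}.
Local Notation K := (scalar_field R k).
Context {X : completeNormedModType K}.

(** The initial topology of a map into a product is tested coordinatewise.
    One implication uses that each strip where one u varies by less than e is
    open, the other that convergence in a product is pointwise. *)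
Lemma weak_op_nbhsP (G : set (bilinear_form (dual_space X) X -> K))
    (N : net (bounded_op X X)) (S0 : bounded_op X X) :
  (forall O, weak_op_topology X G O -> O S0 ->
     \forall a \near net_filter N, O (N a)) <->
  (forall u, G u -> forall e, 0 < e ->
     \forall a \near net_filter N,
       rnorm (duality u S0 - duality u (N a)) < e).
Proof.
pose f (T : bounded_op X X) : {ptws G -> K} := fun u => duality (val u) T.
split=> [h u Gu e e0|h].
  pose u' : G := SigSub (mem_set Gu).
  pose B : set K := [set z | rnorm (duality u S0 - z) < e].
  have oB : open B.
    rewrite openE => z /= Bz; apply/nbhs_ballP => /=.
    exists (to_scalar k (e - rnorm (duality u S0 - z))).
      by rewrite /= -to_scalar0 ltr_to_scalar subr_gt0.
    move=> y; rewrite -ball_normE /= -to_scalar_rnorm ltr_to_scalar => zy.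
    rewrite /B /= -(subrK z (duality u S0)) -addrA.
    by apply: le_lt_trans (ler_rnormD _ _) _; rewrite -ltrBrDl.
  apply: (h (f @^-1` ((fun g : {ptws G -> K} => g u') @^-1` B))); last first.
    by rewrite /= /B /= subrr rnorm0.
  exists ((fun g : {ptws G -> K} => g u') @^-1` B) => //.
  rewrite openE => g Bg.
  have : nbhs (g : {ptws G -> K}) --> (g : {ptws G -> K}) by exact: cvg_id.
  move=> /cvg_sup/(_ u'); apply.
  by exists ((fun g : {ptws G -> K} => g u') @^-1` B); split=> //; exists B.
move=> O [B oB <-] BS0.
have : (f \o N) @ net_filter N --> (f S0 : {ptws G -> K}).
  apply/cvg_sup => -[u Gu] C [_ [[D oD <-] DS0 DC]].
  have : (fun a => duality u (N a)) @ net_filter N --> duality u S0.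
    apply/cvg_rnormP => e e0; apply: h => //; exact: set_mem.
  move=> /(_ D (open_nbhs_nbhs (conj oD DS0))) ND.
  change (net_filter N [set a | C (f (N a))]).
  by apply: (@filterS _ (net_filter N) _ _ _ _ ND) => a Da; exact: DC.
by move=> /(_ B (open_nbhs_nbhs (conj oB BS0))).
Qed.

End weak_operator_topology.

(** * Trace functionals and null tensors *)

Section trace_functionals.
Context {R : realType} {k : scalar_kind}.
Local Notation K := (scalar_field R k).
Implicit Types X Y Z W : completeNormedModType K.

(** These are S |-> <v, T S> for v in the projective tensor product of Y^* and
    X, the functionals to which the trace inequality for T applies. *)
Definition trace_functional X Y (T : bounded_op X Y)
    (phi : bounded_op X X -> K) :=
  exists (f : nat -> dual_space Y) (x : nat -> X),
    (\sum_(n <oo) (rnorm (f n) * rnorm (x n))%:E < +oo)%E /\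
    forall S, phi S = limn (series (fun n => f n (T (S (x n))))).

Lemma pairing_le X Y (T : bounded_op X Y) (f : nat -> dual_space Y)
    (x : nat -> X) n :
  rnorm (f n (T (x n))) <= opnorm T * (rnorm (f n) * rnorm (x n)).
Proof.
rewrite (le_trans (rnorm_op _ _))// -rnormE mulrCA ler_wpM2l ?rnorm_ge0//.
exact: rnorm_op.
Qed.

Lemma le_summable (b b' : nat -> R) (c : R) : (forall n, 0 <= b n) ->
  (forall n, 0 <= b' n) -> (forall n, b' n <= c * b n) -> 0 <= c ->
  (\sum_(n <oo) (b n)%:E < +oo)%E -> (\sum_(n <oo) (b' n)%:E < +oo)%E.
Proof.
move=> b0 b0' b'b c0 bs.
apply: (@le_lt_trans _ _ (\sum_(n <oo) (c%:E * (b n)%:E))%E).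
  by apply: lee_nneseries => n *; rewrite -?EFinM lee_fin.
by rewrite nneseriesZl ?lte_mul_pinfty ?lee_fin// => n _; rewrite lee_fin.
Qed.

Lemma cvg_pairing X Y (T : bounded_op X Y) (f : nat -> dual_space Y)
    (x : nat -> X) :
  (\sum_(n <oo) (rnorm (f n) * rnorm (x n))%:E < +oo)%E ->
  cvgn (series (fun n => f n (T (x n)))).
Proof.
move=> fx; apply: (cvg_dominated_series (pairing_le T f x)).
by apply: le_summable fx => // [n|n|]; rewrite ?mulr_ge0 ?rnorm_ge0 ?opnorm_ge0.
Qed.

Lemma trace_functional0 X Y (T : bounded_op X Y) :
  trace_functional T (fun=> 0).
Proof.
exists (fun=> 0), (fun=> 0); split=> [|S].
  by rewrite eseries0// => n _ _; rewrite rnorm0 mul0r.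
apply/esym/cvg_lim => //; rewrite [X in X @ _](_ : _ = cst 0); first exact: cvg_cst.
by apply/funext => n; rewrite /series/= big1.
Qed.

(** Interleaving the two representing series keeps a single sequence of
    functionals and of vectors, as the trace inequality demands. *)
Lemma trace_functionalD X Y (T : bounded_op X Y) phi psi :
  trace_functional T phi -> trace_functional T psi ->
  trace_functional T (fun S => phi S + psi S).
Proof.
move=> [f [x [fx phiE]]] [g [y [gy psiE]]].
exists (interleave f g), (interleave x y).
have fg : (\sum_(n <oo) (rnorm (interleave f g n) * rnorm (interleave x y n))%:E
    < +oo)%E.
  suff /eq_eseriesr -> : forall n, xpredT n ->
      (rnorm (interleave f g n) * rnorm (interleave x y n))%:E =
      (interleave (fun n => rnorm (f n) * rnorm (x n))
         (fun n => rnorm (g n) * rnorm (y n)) n)%:E.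
    by apply: summable_interleave => // n; rewrite mulr_ge0 ?rnorm_ge0.
  by move=> n _; rewrite /interleave; case: odd.
split=> // S; rewrite phiE psiE -lim_series_interleave.
- congr (limn (series _)); apply/funext => n.
  by rewrite /interleave; case: odd.
- exact: (cvg_pairing (T := comp_op T S) fx).
- exact: (cvg_pairing (T := comp_op T S) gy).
- rewrite (_ : interleave _ _ =
    fun n => interleave f g n (comp_op T S (interleave x y n))).
    exact: cvg_pairing.
  by apply/funext => n; rewrite /interleave; case: odd.
Qed.

Lemma trace_functionalZ X Y (T : bounded_op X Y) phi (a : K) :
  trace_functional T phi -> trace_functional T (fun S => a * phi S).
Proof.
move=> [f [x [fx phiE]]]; exists f, (fun n => a *: x n); split=> [|S].
  apply: le_summable (rnorm_ge0 a) fx => n; rewrite ?mulr_ge0 ?rnorm_ge0//.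
  by rewrite rnormZ mulrCA.
rewrite phiE; apply/esym/cvg_lim => //.
rewrite (_ : series _ = a \*: series (fun n => f n (T (S (x n))))).
  by apply: cvgZr; exact: (cvg_pairing (T := comp_op T S) fx).
apply/funext => n; rewrite /= /series/= scaler_sumr; apply: eq_bigr => i _.
by rewrite !linearZ.
Qed.

Lemma trace_functional_sum X Y (T : bounded_op X Y) n
    (phi : 'I_n -> bounded_op X X -> K) :
  (forall i, trace_functional T (phi i)) ->
  trace_functional T (fun S => \sum_i phi i S).
Proof.
elim: n phi => [|n IHn] phi phiT.
  rewrite (_ : (fun S => _) = fun=> 0); first exact: trace_functional0.
  by apply/funext => S; rewrite big_ord0.
rewrite (_ : (fun S => _) =
    fun S => phi ord0 S + \sum_i phi (lift ord0 i) S).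
  by apply: trace_functionalD => //; exact: IHn.
by apply/funext => S; rewrite big_ord_recl.
Qed.

Lemma trace_functional_factor X Y W (T : bounded_op X Y) (T' : bounded_op X W)
    (P : bounded_op W Y) phi :
  comp_op P T' = T -> trace_functional T phi -> trace_functional T' phi.
Proof.
move=> <- [f [x [fx phiE]]]; exists (fun n => comp_op (f n) P), x; split=> //.
apply: le_summable (opnorm_ge0 P) fx => n; rewrite ?mulr_ge0 ?rnorm_ge0//.
rewrite mulrA ler_wpM2r ?rnorm_ge0//.
rewrite rnormE opnorm_le ?mulr_ge0 ?opnorm_ge0 ?rnorm_ge0// => w.
rewrite (le_trans (rnorm_op (f n) (P w)))// -rnormE.
by rewrite (mulrC (opnorm P)) -mulrA ler_wpM2l ?rnorm_ge0// rnorm_op.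
Qed.

Lemma trace_functional_linear X Y (T : bounded_op X Y) phi :
  trace_functional T phi -> forall (a : K) S S',
    phi (a *: S + S') = a * phi S + phi S'.
Proof.
move=> [f [x [fx phiE]]] a S S'; rewrite !phiE; apply/cvg_lim => //.
rewrite (_ : series _ = (a \*: series (fun n => f n (T (S (x n))))) \+
                        series (fun n => f n (T (S' (x n))))).
  apply: cvgD; last exact: (cvg_pairing (T := comp_op T S') fx).
  by apply: cvgZr; exact: (cvg_pairing (T := comp_op T S) fx).
apply/funext => n; rewrite /= /series/= scaler_sumr -big_split.
by apply: eq_bigr => i _; rewrite /= !linearP.
Qed.

Lemma trace_functionalZE X Y (T : bounded_op X Y) phi :
  trace_functional T phi -> forall (a : K) S, phi (a *: S) = a * phi S.
Proof.
move=> phiT a S; have lphi := trace_functional_linear phiT.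
have := lphi 1 0 0; rewrite scaler0 addr0 mul1r -[X in X = _]addr0 => /addrI p0.
by have := lphi a S 0; rewrite addr0 -p0 addr0.
Qed.

(** The sequence (f, 0, 0, ...) is the image of the null sequence
    (1, 0, 0, ...) under a |-> a f, and the adjoint of this rank-one operator
    has rank one, hence lies in every ideal. *)
Lemma rank_one_null_tensor X (B : banach_ideal R k)
    (f : dual_space X) (x : X) :
  exists2 u, null_tensor (dual_ideal B) X u & forall S, duality u S = f (S x).
Proof.
pose fs n : dual_space X := if n is 0 then f else 0.
pose xs n : X := if n is 0 then x else 0.
exists (tensor_series fs xs).
  exists fs, xs; split=> //; last first.
    apply/nneseries_bounded => [n|]; first exact: rnorm_ge0.
    exists (rnorm x); case=> [|n].
      by rewrite /series /= big_geq// rnorm_ge0.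
    rewrite /series /= big_nat_recl//= big1 ?addr0// => i _.
    exact: rnorm0.
  have Ub : is_bounded_op (fun a : K => a *: f).
    split=> [a b c|]; first by rewrite scalerDl scalerA.
    by exists (rnorm f) => a; rewrite rnormZ mulrC.
  exists K, (mk_bounded_op Ub), (fun n => if n is 0 then 1 else 0); split.
  - apply: ideal_finite_rank; exists 1%N, (fun=> id_op K) => g.
    exists (fun=> g f); rewrite big_ord1; apply/val_inj/funext => a /=.
    by rewrite linearZ /= /GRing.scale/= mulrC.
  - apply/cvg_rnormP => e e0; exists 1%N => // -[|n]//= _.
    by rewrite subrr rnorm0.
  - by case=> [|n] /=; rewrite ?scale1r ?scale0r.
move=> S; rewrite duality_tensor_series; apply/cvg_lim => //.
apply: cvg_near_cst; exists 1%N => // -[//|n] _ /=.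
by rewrite /series /= big_nat_recl//= big1 ?addr0.
Qed.

End trace_functionals.

Section augmentation.
Context {R : realType} {k : scalar_kind}.
Local Notation K := (scalar_field R k).
Context (A : banach_ideal R k).
Implicit Types X Y Z W : completeNormedModType K.

Lemma eval_subproof X (x : X) : is_bounded_op (fun f : dual_space X => f x).
Proof.
split=> [a f g|]; first by [].
by exists (rnorm x) => f; rewrite mulrC rnormE; exact: rnorm_op.
Qed.
Definition eval_at X (x : X) : dual_space (dual_space X) :=
  mk_bounded_op (eval_subproof x).

Lemma canonical_embedding_subproof X : is_bounded_op (@eval_at X).
Proof.
split=> [a x y|].
  by apply/val_inj/funext => f /=; rewrite linearP.
exists 1 => x; rewrite mul1r rnormE opnorm_le ?rnorm_ge0// => f /=.
by rewrite mulrC rnormE; exact: rnorm_op.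
Qed.
Definition canonical_embedding X : bounded_op X (dual_space (dual_space X)) :=
  mk_bounded_op (@canonical_embedding_subproof X).

(** The point of the proof. Let u be the sum of the U z_n (x) x_n with z_n null
    in Z and the adjoint of U in the ideal. Restricting this adjoint to X
    gives V : X -> Z^* in the ideal with (U z_n) x = (V x) z_n. So the operator
    T' x = (T x, d V x) into Y * Z^* is in the ideal, has ideal norm at most
    |T| + d |V|, and sees u: the functional d^-1 z_n on the second factor
    recovers U z_n, and the products |z_n| |x_n| are summable. *)
Lemma null_tensor_augment X Y (T : bounded_op X Y) u (e : R) :
    ideal_mem A T -> null_tensor (dual_ideal A) X u -> 0 < e ->
  exists W (T' : bounded_op X W) (P : bounded_op W Y),
    [/\ ideal_mem A T', comp_op P T' = T, opnorm P <= 1,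
        ideal_norm A T' <= ideal_norm A T + e & trace_functional T' (duality u)].
Proof.
move=> AT [f [x [[Z [U [z [AU z0 fE]]]] xs ->]]] e0.
pose V : bounded_op X (dual_space Z) :=
  comp_op (adjoint U) (canonical_embedding X).
have AV : ideal_mem A V by exact: ideal_mem_compr.
have V0 := ideal_norm_ge0 AV.
(* Chosen so that d |V| <= e; the 1 is there in case V = 0. *)
pose d := e / (ideal_norm A V + 1).
have d0 : 0 < d by rewrite divr_gt0// ltr_wpDl.
pose dK : K := to_scalar k d.
have dK0 : dK != 0 by rewrite /dK -to_scalar0 (can_eq to_scalarK) gt_eqF.
pose T' := comp_op (inl_op Y (dual_space Z)) T +
           dK *: comp_op (inr_op Y (dual_space Z)) V.
have A1 := ideal_mem_compl (inl_op Y (dual_space Z)) AT.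
have A2 := ideal_mem_compl (inr_op Y (dual_space Z)) AV.
exists (Y * dual_space Z)%type, T', (fst_op Y (dual_space Z)); split.
- by apply: ideal_memD => //; exact: ideal_memZ.
- by apply/val_inj/funext => w /=; rewrite scaler0 addr0.
- exact: opnorm_fst.
- apply: le_trans (ideal_normD A1 (ideal_memZ _ A2)) _.
  rewrite ideal_normZ// rnorm_to_scalar ?(ltW d0)//; apply: lerD.
    apply: le_trans (ideal_norm_compl _ AT) _.
    by rewrite ler_piMl ?opnorm_inl// ideal_norm_ge0.
  rewrite /d mulrAC ler_pdivrMr ?ltr_wpDl// ler_wpM2l ?(ltW e0)//.
  apply: le_trans (ideal_norm_compl _ AV) _.
  apply: (@le_trans _ _ (ideal_norm A V)); last by rewrite lerDl.
  by rewrite ler_piMl ?opnorm_inr.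
have [M zM] : exists M : R, forall n, rnorm (z n) <= M.
  have /cvg_seq_bounded[M [_ zM]] : cvgn z by apply: cvgP z0.
  exists (real_part (M + 1)) => n.
  have h : `|z n| <= M + 1 by apply: zM => //; rewrite ltrDl.
  rewrite -(@ler_to_scalar R k) to_scalar_rnorm real_partK//.
  exact: le_trans h.
exists (fun n => dK^-1 *: comp_op (eval_at (z n)) (snd_op Y (dual_space Z))), x.
have M0 : 0 <= M by apply: le_trans (zM 0%N); exact: rnorm_ge0.
split=> [|S]; last first.
  rewrite duality_tensor_series; congr (limn (series _)); apply/funext => n.
  rewrite fE; transitivity (dK^-1 * (0 + dK * U (z n) (S (x n)))) => //.
  by rewrite add0r mulrA mulVf ?mul1r.
pose C := rnorm dK^-1 * M.
have C0 : 0 <= C by rewrite mulr_ge0 ?rnorm_ge0.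
apply: (le_summable _ _ _ C0 xs) => n; rewrite ?mulr_ge0 ?rnorm_ge0//.
rewrite ler_wpM2r ?rnorm_ge0// rnormE opnorm_le// => w.
rewrite [leLHS](rnormZ dK^-1) -mulrA ler_wpM2l ?rnorm_ge0//.
rewrite (le_trans (rnorm_op w.2 (z n)))// mulrC ler_pM ?rnorm_ge0 ?opnorm_ge0//.
by rewrite -rnormE; exact: rnorm_snd.
Qed.

Lemma null_tensors_augment X Y (T : bounded_op X Y) n
    (u : 'I_n -> bilinear_form (dual_space X) X -> K) (e : R) :
    ideal_mem A T -> (forall i, null_tensor (dual_ideal A) X (u i)) -> 0 < e ->
  exists W (T' : bounded_op X W) (P : bounded_op W Y),
    [/\ ideal_mem A T', comp_op P T' = T, opnorm P <= 1,
        ideal_norm A T' <= ideal_norm A T + e &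
        forall i, trace_functional T' (duality (u i))].
Proof.
move=> AT; elim: n u e => [|n IHn] u e uG e0.
  exists Y, T, (id_op Y); split; rewrite ?comp_id_op ?opnorm_id//; last by case.
  by rewrite lerDl ltW.
have e2 : 0 < e / 2 by rewrite divr_gt0.
have [W [T' [P [AT' PT' P1 T'e uT']]]] :=
  IHn (fun i => u (lift ord0 i)) _ (fun i => uG _) e2.
have [W2 [T2 [P2 [AT2 PT2 P21 T2e uT2]]]] := null_tensor_augment AT' (uG ord0) e2.
exists W2, T2, (comp_op P P2); split=> //.
- by rewrite -PT' -PT2; exact/val_inj.
- apply: opnorm_le => // w; rewrite mul1r.
  rewrite (le_trans (rnorm_op P (P2 w)))// (le_trans _ (_ : rnorm (P2 w) <= _))//.
    by rewrite ler_piMl ?rnorm_ge0.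
  by rewrite (le_trans (rnorm_op P2 w))// ler_piMl ?rnorm_ge0.
- by rewrite (splitr e); lra.
- move=> i; case: (unliftP ord0 i) => [j|] -> //.
  exact: trace_functional_factor PT2 (uT' j).
Qed.

End augmentation.

(** * The four equivalent properties *)

Section equivalences.
Context {R : realType} {k : scalar_kind}.
Local Notation K := (scalar_field R k).
Context (A : banach_ideal R k) (lambda : R) (X : completeNormedModType K).
Context (lambda_ge1 : 1 <= lambda).
Implicit Types Y Z W : completeNormedModType K.

Let lambda_gt0 : 0 < lambda.
Proof. by rewrite (lt_le_trans ltr01). Qed.

Definition weak_approximation : Prop :=
  forall Y (T : bounded_op X Y), ideal_mem A T ->
    exists N : net (bounded_op X X),
      [/\ forall a, finite_rank (N a),
          (net_limsup N (fun S => ideal_norm A (comp_op T S)) <=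
            (lambda * ideal_norm A T)%:E)%E &
          forall x, T (N a x) @[a --> net_filter N] --> T x].

Definition trace_inequality : Prop :=
  forall Y (T : bounded_op X Y), ideal_mem A T -> ideal_norm A T = 1 ->
    forall (f : nat -> dual_space Y) (x : nat -> X),
      (\sum_(n <oo) (rnorm (f n) * rnorm (x n))%:E < +oo)%E ->
      ((rnorm (limn (series (fun n => f n (T (x n))))))%:E <=
        lambda%:E *
        ereal_sup [set (rnorm (limn (series (fun n => f n (T (S (x n)))))))%:E
                  | S in [set S : bounded_op X X |
                          finite_rank S /\ (ideal_norm A (comp_op T S) <= 1)%R]])%E.

Lemma weak_BAP_approximation : weak_BAP_for A lambda X -> weak_approximation.
Proof.
move=> h Y T AT; have [N [Nfr Nx Nlim]] := h Y T AT.
by exists N; split=> // x; apply: cvg_op.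
Qed.

(** For large a, |T S_a| <= lambda + e in the ideal norm, so the functional
    of S_a is at most (lambda + e) times the supremum; and T S_a -> T pointwise
    makes it converge to the functional of the identity, the tails being
    uniformly small. *)
Lemma weak_approximation_trace : weak_approximation -> trace_inequality.
Proof.
move=> h Y T AT T1 f x fx; have [N [Nfr Nlim Nx]] := h Y T AT.
set E := [set _ | _ in _]; pose phi (S : bounded_op X X) :=
  limn (series (fun n => f n (T (S (x n))))).
have phiT : trace_functional T phi by exists f, x.
have Eub S : finite_rank S -> ideal_norm A (comp_op T S) <= 1 ->
    ((rnorm (phi S))%:E <= ereal_sup E)%E.
  by move=> fS TS; apply: ereal_sup_ubound; exists S.
have [_ T0] := ideal_ball0 AT ler01.
have := Eub 0 (finite_rank0 _ _) T0.
case: (ereal_sup E) Eub => [s| |//] Eub s0; last by rewrite gt0_muley ?lte_fin// leey.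
have {}s0 : 0 <= s by move: s0; rewrite lee_fin; apply: le_trans; exact: rnorm_ge0.
rewrite -EFinM lee_fin -/(phi (id_op X)).
suff key e : 0 < e -> rnorm (phi (id_op X)) <= (lambda + e) * s + e.
  apply/ler_addgt0Pr => d d0.
  have s1 : 0 < s + 1 by rewrite ltr_wpDl.
  have := key (d / (s + 1)); rewrite divr_gt0// => /(_ isT).
  rewrite mulrDl -addrA -[X in _ <= _ + (_ + X)]mulr1 -mulrDr divfK//.
  by rewrite gt_eqF.
move=> e0; have le0 : 0 < lambda + e by rewrite addr_gt0.
pose b n := (lambda + e) * (rnorm (f n) * rnorm (x n)).
have fx0 n : 0 <= rnorm (f n) * rnorm (x n) by rewrite mulr_ge0 ?rnorm_ge0.
have b0 n : 0 <= b n by rewrite mulr_ge0 ?(ltW le0).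
have bs : (\sum_(n <oo) (b n)%:E < +oo)%E.
  exact: (le_summable fx0 b0 _ (ltW le0) fx).
pose u (S : bounded_op X X) n := f n (T (S (x n))).
have ub S : ideal_norm A (comp_op T S) <= lambda + e ->
    forall n, rnorm (u S n) <= b n.
  move=> TS n; rewrite /u /b.
  apply: le_trans (rnorm_functional_ideal (f n) (x n) (ideal_mem_compr S AT)) _.
  rewrite -rnormE mulrA ler_wpM2r ?rnorm_ge0// mulrC.
  by rewrite ler_wpM2r ?rnorm_ge0.
have e4 : 0 < e / 4 by rewrite divr_gt0.
have [n nP] := dominated_series (k := k) b0 bs e4.
have un : series (u (N a)) n @[a --> net_filter N] --> series (u (id_op X)) n.
  rewrite /series/=; apply: cvg_big => [|i _]; first exact: add_continuous.
  by apply: cvg_op; exact: Nx.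
have e2 : 0 < e / 2 by rewrite divr_gt0.
move/cvg_rnormP : un => /(_ _ e2) un.
have {}un : \forall a \near net_filter N,
  rnorm (series (u (id_op X)) n - series (u (N a)) n) < e / 2 by exact: un.
move/net_limsup_leP : Nlim => /(_ _ e0).
rewrite T1 mulr1 => Nlim.
have [a [/= una TNa]] := filter_ex (filterI un Nlim).
have uid : forall n, rnorm (u (id_op X) n) <= b n.
  by apply: ub; rewrite comp_op_id T1 -[leLHS]addr0 lerD// ltW.
have [_ tid] := nP _ uid; have [_ ta] := nP _ (ub _ TNa).
have : rnorm (phi (N a)) <= (lambda + e) * s.
  (* Dividing S_a by lambda + e makes it a competitor in the supremum. *)
  pose c : K := to_scalar k (lambda + e)^-1.
  have rc : rnorm c = (lambda + e)^-1 by rewrite rnorm_to_scalar// invr_ge0 ltW.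
  have := Eub (c *: N a) (finite_rankZ c (Nfr a)).
  rewrite comp_opZ ideal_normZ ?rc; last exact: ideal_mem_compr.
  rewrite ler_pdivrMl// mulr1 => /(_ TNa); rewrite lee_fin.
  by rewrite (trace_functionalZE phiT) (rnormZ c (phi (N a) : K)) rc ler_pdivrMl.
move: tid ta una; rewrite -/(phi (id_op X)) -/(phi (N a)).
set p := phi _; set q := phi _; set y := series _ n; set z := series _ n.
move=> py qz yz qs.
have -> : p = (p - y) + (y - z) + (z - q) + q by rewrite !addrA !subrK.
have := ler_rnormD ((p - y) + (y - z) + (z - q)) q.
have := ler_rnormD ((p - y) + (y - z)) (z - q).
have := ler_rnormD (p - y) (y - z).
move: qz; rewrite rnormB; lra.
Qed.

(** The trace inequality for an operator of arbitrary ideal norm t: divide T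
    by t, and multiply the functionals on Y by t to keep the trace functional
    unchanged. When t = 0 the trace functional vanishes. *)
Lemma trace_inequality_homogeneous Y (T : bounded_op X Y) phi (B : R) :
  trace_inequality -> ideal_mem A T -> trace_functional T phi ->
  (forall S, ideal_ball A T (ideal_norm A T) S -> rnorm (phi S) <= B) ->
  rnorm (phi (id_op X)) <= lambda * B.
Proof.
move=> h AT phiT phiB; have t0 := ideal_norm_ge0 AT.
have B0 : 0 <= B by apply: le_trans (phiB 0 (ideal_ball0 AT t0)); exact: rnorm_ge0.
have [T0|T0] := eqVneq (ideal_norm A T) 0.
  have -> : phi (id_op X) = phi 0.
    have [f [x [_ phiE]]] := phiT; rewrite !phiE (ideal_norm_eq0 AT T0).
    by congr (limn (series _)); apply/funext => n /=; rewrite !linear0.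
  apply: le_trans (phiB 0 (ideal_ball0 AT t0)) _.
  by rewrite ler_peMl.
have {}t0 : 0 < ideal_norm A T by rewrite lt_neqAle eq_sym T0.
pose t := ideal_norm A T; pose c : K := to_scalar k t.
have rc : rnorm c = t by rewrite rnorm_to_scalar// ltW.
have c0 : c != 0 by rewrite /c -to_scalar0 (can_eq to_scalarK) gt_eqF.
have rcV : rnorm c^-1 = t^-1.
  apply: (mulfI (lt0r_neq0 t0)); rewrite divff//.
  rewrite -[X in X * _]rc -(rnormZ c (c^-1 : K)) /GRing.scale/= divff//.
  by rewrite -to_scalar1 rnorm_to_scalar.
pose T1 : bounded_op X Y := c^-1 *: T.
have AT1 : ideal_mem A T1 by exact: ideal_memZ.
have T11 : ideal_norm A T1 = 1 by rewrite ideal_normZ// rcV mulVf.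
have [f [x [fx phiE]]] := phiT.
have cfx : (\sum_(n <oo) (rnorm (c *: f n) * rnorm (x n))%:E < +oo)%E.
  apply: (le_summable _ _ _ (rnorm_ge0 c) fx) => n; rewrite ?mulr_ge0 ?rnorm_ge0//.
  by rewrite rnormZ mulrA.
have cE (S : bounded_op X X) :
    limn (series (fun n => (c *: f n) (T1 (S (x n))))) = phi S.
  rewrite phiE; congr (limn (series _)); apply/funext => n.
  rewrite [LHS](_ : _ = c * f n (c^-1 *: T (S (x n))))// linearZ /=.
  by rewrite /GRing.scale /= mulrA divff// mul1r.
have := h Y T1 AT1 T11 _ x cfx; rewrite [limn _](cE (id_op X)) -lee_fin.
move=> /le_trans; apply; rewrite EFinM lee_wpmul2l ?lee_fin ?(ltW lambda_gt0)//.
apply: ge_ereal_sup => _ [S [fS TS] <-]; rewrite cE lee_fin; apply: phiB.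
split=> //; rewrite -[leRHS]mulr1 -ler_pdivrMl// -rcV -ideal_normZ.
  by have <- : comp_op T1 S = c^-1 *: comp_op T S by exact/val_inj.
exact: ideal_mem_compr.
Qed.

(** Given finitely many null tensors u_i, augment T to an operator T' of
    almost the same ideal norm for which all the u_i are trace functionals.
    If no finite-rank S with |T' S| <= lambda |T'| brings all the <u_i, S>
    near <u_i, I>, separation in K^n yields one combination phi of the u_i
    whose value at I exceeds its values on these S by e; but phi is again a
    trace functional for T', which contradicts the trace inequality. Finally
    |T S| <= |T' S| because T is T' followed by a projection. *)
Lemma trace_inequality_BAP : trace_inequality ->
  BAP_for A lambda X (tau_ideal (dual_ideal A) X).
Proof.
move=> h Y T AT; pose G := null_tensor (dual_ideal A) X.
have [|N [Nfr NG Nlim]] := @approximation_net R (bounded_op X X) G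
  (@finite_rank R k X X)
  (fun u S => rnorm (duality (val u) (id_op X) - duality (val u) S))
  (fun S => ideal_norm A (comp_op T S)) (lambda * ideal_norm A T); last first.
  exists N; split=> //; apply/weak_op_nbhsP => u Gu e e0.
  exact: (NG (SigSub (mem_set Gu)) e e0).
move=> s e e0; pose n := size s.
pose u (i : 'I_n) := val (tnth (in_tuple s) i).
have Gu i : G (u i) by apply: set_mem; exact: valP.
(* The norm of T' is multiplied by lambda in the final estimate. *)
have el0 : 0 < e / lambda by rewrite divr_gt0.
have [W [T' [P [AT' PT' P1 T'e uT']]]] := null_tensors_augment AT Gu el0.
pose r := lambda * ideal_norm A T'.
have r0 : 0 <= r by rewrite mulr_ge0 ?(ltW lambda_gt0) ?ideal_norm_ge0.
have re : r <= lambda * ideal_norm A T + e.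
  by rewrite -ler_pdivlMl// mulrDr mulKf ?gt_eqF// [_^-1 * e]mulrC.
have [[S [fS T'S] Se]|far] := pselect (exists2 S, ideal_ball A T' r S &
    \sum_i rnorm (duality (u i) (id_op X) - duality (u i) S) < e).
  exists S; split=> //.
    apply: le_trans re; apply: le_trans T'S.
    rewrite -PT' (_ : comp_op _ S = comp_op P (comp_op T' S)); last exact/val_inj.
    have AT'S := ideal_mem_compr S AT'.
    rewrite (le_trans (ideal_norm_compl P AT'S))//.
    by rewrite ler_piMl ?ideal_norm_ge0.
  move=> j js; have /tnthP[i ->] : j \in in_tuple s by [].
  apply: le_lt_trans Se.
  by rewrite (bigD1 i)//= lerDl sumr_ge0// => l _; exact: rnorm_ge0.
exfalso.
have [| | |f fC] := @power_separation R k K n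
  [set (fun i => duality (u i) S) | S in ideal_ball A T' r]
  (fun i => duality (u i) (id_op X)) e.
- move=> _ _ a b [S BS <-] [S' BS' <-] ab; exists (a *: S + b *: S').
    exact: absconvex_ideal_ball.
  apply/funext => i; rewrite (trace_functional_linear (uT' i)).
  by rewrite (trace_functionalZE (uT' i)).
- by exists (fun i => duality (u i) 0), 0 => //; exact: ideal_ball0.
- move=> _ [S BS <-]; rewrite leNgt; apply/negP => Se; apply: far; by exists S.
pose phi S := \sum_i f i (duality (u i) S).
have phiT : trace_functional T' phi.
  rewrite (_ : phi = fun S => \sum_i f i 1 * duality (u i) S).
    by apply: trace_functional_sum => i; exact: trace_functionalZ.
  apply/funext => S; apply: eq_bigr => i _.
  exact: scalar_functionalE.
suff /(trace_inequality_homogeneous h AT' phiT) : forall S,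
    ideal_ball A T' (ideal_norm A T') S ->
    rnorm (phi S) <= (rnorm (phi (id_op X)) - e) / lambda.
  by rewrite mulrC divfK ?gt_eqF//; lra.
move=> S [fS TS]; rewrite ler_pdivlMr// lerBrDr mulrC.
(* S has |T' S| <= |T'|, so lambda S is in the separated set. *)
pose c : K := to_scalar k lambda.
have rc : rnorm c = lambda by rewrite rnorm_to_scalar// ltW.
rewrite -rc -(rnormZ c (phi S : K)) -[_ *: _](trace_functionalZE phiT) addrC.
apply: fC; exists (c *: S) => //; split; first exact: finite_rankZ.
rewrite comp_opZ ideal_normZ ?rc ?ler_wpM2l ?(ltW lambda_gt0)//.
exact: ideal_mem_compr.
Qed.

(** Elementary tensors f (x) x belong to the duality, so the topology is finer
    than the weak operator topology. As the finite-rank S with |T S| <= r form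
    a convex set, Mazur's theorem in X^n upgrades weak approximation at
    finitely many points to norm approximation. *)
Lemma BAP_weak_BAP : BAP_for A lambda X (tau_ideal (dual_ideal A) X) ->
  weak_BAP_for A lambda X.
Proof.
move=> h Y T AT.
have [|N [Nfr Nx Nlim]] := @approximation_net R (bounded_op X X) X
  (@finite_rank R k X X) (fun x S => rnorm (x - S x))
  (fun S => ideal_norm A (comp_op T S)) (lambda * ideal_norm A T); last first.
  by exists N; split=> // x; apply/cvg_rnormP => e e0; exact: Nx.
move=> s e e0; pose n := size s; pose v (i : 'I_n) := tnth (in_tuple s) i.
pose r := lambda * ideal_norm A T + e.
have r0 : 0 <= r.
  by rewrite addr_ge0 ?(ltW e0)// mulr_ge0 ?(ltW lambda_gt0) ?ideal_norm_ge0.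
have [[S [fS TS] Se]|far] := pselect (exists2 S, ideal_ball A T r S &
    \sum_i rnorm (v i - S (v i)) < e).
  exists S; split=> // x xs; have /tnthP[i ->] : x \in in_tuple s by [].
  apply: le_lt_trans Se.
  by rewrite (bigD1 i)//= lerDl sumr_ge0// => l _; exact: rnorm_ge0.
exfalso.
have [| | |f fC] := @power_separation R k X n
  [set (fun i => S (v i)) | S in ideal_ball A T r] v e.
- move=> _ _ a b [S BS <-] [S' BS' <-] ab; exists (a *: S + b *: S') => //.
  exact: absconvex_ideal_ball.
- by exists (fun i => 0), 0 => //; exact: ideal_ball0.
- move=> _ [S BS <-]; rewrite leNgt; apply/negP => Se; apply: far; by exists S.
have [N [Nfr Nt Nlim]] := h Y T AT.
have Nf i : f i (N a (v i)) @[a --> net_filter N] --> f i (v i).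
  have [u Gu uE] := rank_one_null_tensor A (f i) (v i).
  apply/cvg_rnormP => d d0.
  have := (weak_op_nbhsP _ _ _).1 Nt u Gu d d0.
  by apply: filterS => a; rewrite !uE.
have : \sum_i f i (N a (v i)) @[a --> net_filter N] --> \sum_i f i (v i).
  by apply: cvg_big => [|i _]; [exact: add_continuous | exact: Nf].
move=> /cvg_rnormP /(_ _ e0) near_v.
have {}near_v : \forall a \near net_filter N,
  rnorm (\sum_i f i (v i) - \sum_i f i (N a (v i))) < e by exact: near_v.
move/net_limsup_leP : Nlim => /(_ _ e0) Nlim.
have [a [/= va TNa]] := filter_ex (filterI near_v Nlim).
have : e + rnorm (\sum_i f i (N a (v i))) <= rnorm (\sum_i f i (v i)).
  by apply: fC; exists (N a).
have := ler_rnormD (\sum_i f i (v i) - \sum_i f i (N a (v i)))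
  (\sum_i f i (N a (v i))).
rewrite subrK; lra.
Qed.

End equivalences.

Theorem theorem2p6 (R : realType) (k : scalar_kind) (A : banach_ideal R k)
    (lambda : R) (lambda_ge1 : 1 <= lambda)
    (X : completeNormedModType (scalar_field R k)) :
  [<-> weak_BAP_for A lambda X;
       forall (Y : completeNormedModType (scalar_field R k)) (T : bounded_op X Y),
         ideal_mem A T ->
         exists N : net (bounded_op X X),
           [/\ forall a, finite_rank (N a),
               (net_limsup N (fun S => ideal_norm A (comp_op T S)) <=
                 (lambda * ideal_norm A T)%:E)%E &
               forall x, T (N a x) @[a --> net_filter N] --> T x];
       forall (Y : completeNormedModType (scalar_field R k)) (T : bounded_op X Y),
         ideal_mem A T -> ideal_norm A T = 1 ->
         forall (f : nat -> dual_space Y) (x : nat -> X),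
           (\sum_(n <oo) (rnorm (f n) * rnorm (x n))%:E < +oo)%E ->
           ((rnorm (limn (series (fun n => f n (T (x n))))))%:E <=
             lambda%:E *
             ereal_sup [set (rnorm (limn (series (fun n => f n (T (S (x n)))))))%:E
                       | S in [set S : bounded_op X X |
                               finite_rank S /\ (ideal_norm A (comp_op T S) <= 1)%R]])%E;
       BAP_for A lambda X (tau_ideal (dual_ideal A) X)].
Proof.
tfae.
- exact: weak_BAP_approximation.
- exact: weak_approximation_trace.
- exact: trace_inequality_BAP.
- exact: BAP_weak_BAP.
Qed.
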